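(* Let $A_1\dots A_n$ be an $n$-mode quantum oscillator, $1\le m\le n$, and $\mathfrak{S}_{\mathrm{cl}}(\mathcal{H}_{A_1\dots A_n})$ the set of its classical states. Let $\mathfrak{S}_0$ be a convex subset of $\mathfrak{S}(\mathcal{H}_{A_1\dots A_n})$ with the property $$\rho\in\mathfrak{S}_0\cap\mathfrak{S}_{\mathrm{cl}}(\mathcal{H}_{A_1\dots A_n})\ \Rightarrow\ \{\sigma\in\mathfrak{S}_{\mathrm{cl}}(\mathcal{H}_{A_1\dots A_n})\,:\,\exists\,\epsilon>0,\ \epsilon\sigma\le\rho\}\subseteq\mathfrak{S}_0,$$ and let $\mathcal{P}_{\mathfrak{S}_0}(\mathbb{C}^n)$ be the subset of $\mathcal{P}(\mathbb{C}^n)$ consisting of measures $\mu$ such that $\rho(\mu)\in\mathfrak{S}_0$. Let $\varepsilon>0$. A) If $f$ is a function in $\widehat{L}^m_n(C,D|\mathfrak{S}_0)$ then $$|f(\rho(\mu))-f(\rho(\nu))|\le C\varepsilon m\,g(E/\varepsilon)+Dg(\varepsilon)$$ for any measures $\mu,\nu\in\mathcal{P}_{\mathfrak{S}_0}(\mathbb{C}^n)$ such that $\sum_{k=1}^m\int_{\mathbb{C}}|z|^2\mu_k(dz)\le mE$, $\sum_{k=1}^m\int_{\mathbb{C}}|z|^2\nu_k(dz)\le mE$ and $\mathrm{TV}(\mu,\nu)\le\varepsilon$. B) If $f$ is a nonnegative function in $\widehat{L}^m_n(C,D|\mathfrak{S}_0)$ and $\mu$ is a measure in $\mathcal{P}_{\mathfrak{S}_0}(\mathbb{C}^n)$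 such that $\sum_{k=1}^m\int_{\mathbb{C}}|z|^2\mu_k(dz)\le mE$, then $$f(\rho(\mu))-f(\rho(\nu))\le C\varepsilon m\,g(E/\varepsilon)+Dg(\varepsilon)$$ for any measure $\nu\in\mathcal{P}_{\mathfrak{S}_0}(\mathbb{C}^n)$ such that $\mathrm{TV}(\mu,\nu)\le\varepsilon$ (the left-hand side may be equal to $-\infty$).
   Context: Each mode $A_k$ is described by the Hilbert space $\mathcal{H}_{A_k}$ of a one-mode quantum oscillator (with Fock basis $\{|j\rangle\}_{j\ge0}$); $\mathcal{H}_{A_1\dots A_n}=\bigotimes_k\mathcal{H}_{A_k}$; $\mathfrak{S}(\cdot)$ is the set of states (positive trace-class operators of unit trace); $\rho_{A_k}$ is the partial trace of $\rho$ onto $A_k$. For $z\in\mathbb{C}$ the coherent vector is $|z\rangle=e^{-|z|^2/2}\sum_{j\ge0}\frac{z^j}{\sqrt{j!}}|j\rangle$, and for $\bar z=(z_1,\dots,z_n)\in\mathbb{C}^n$, $|\bar z\rangle=|z_1\rangle\otimes\cdots\otimes|z_n\rangle$. $\mathcal{P}(\mathbb{C}^n)$ is the set of Borel probability measures on $\mathbb{C}^n$; for $\mu\in\mathcal{P}(\mathbb{C}^n)$, $\rho(\mu)=\int_{\mathbb{C}^n}|\bar z\rangle\langle\bar z|\,\mu(dz_1\dots dz_n)$, and $\mu_k$ is the marginal of $\mu$ corresponding to the $k$-th component of $\bar z$. $\mathfrak{S}_{\mathrm{cl}}(\mathcal{H}_{A_1\dots A_n})$ is the convex closure of the family of coherent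 states $\{|\bar z\rangle\langle\bar z|\}_{\bar z\in\mathbb{C}^n}$, which coincides with $\{\rho(\mu):\mu\in\mathcal{P}(\mathbb{C}^n)\}$. $\mathrm{TV}(\mu,\nu)=\sup_A|\mu(A)-\nu(A)|$ over Borel sets $A$. $S(\rho)=\operatorname{Tr}(-\rho\ln\rho)\in[0,+\infty]$ is the von Neumann entropy, $h_2(p)=-p\ln p-(1-p)\ln(1-p)$ the binary entropy, $g(x)=(x+1)\ln(x+1)-x\ln x$ for $x>0$, $g(0)=0$. Class $L^m_n(C,D|\mathfrak{S}_0)$: all functions $f:\mathfrak{S}_0\to(-\infty,+\infty]$ for which there are nonnegative numbers $c_f^\pm,d_f^\pm$ with $c_f^-+c_f^+=C$, $d_f^-+d_f^+=D$ such that for all $\rho,\sigma\in\mathfrak{S}_0$, $p\in[0,1]$ $$pf(\rho)+(1-p)f(\sigma)-d_f^-h_2(p)\le f(p\rho+(1-p)\sigma)\le pf(\rho)+(1-p)f(\sigma)+d_f^+h_2(p),$$ $$-c_f^-\sum_{k=1}^mS(\rho_{A_k})\le f(\rho)\le c_f^+\sum_{k=1}^mS(\rho_{A_k}),$$ with possible infinite values in both sides (convention $0\cdot(+\infty)=0$). The class $\widehat{L}^m_n(C,D|\mathfrak{S}_0)$ is obtained by adding to $L^m_n(C,D|\mathfrak{S}_0)$ all functions of the form $f(\rho)=\inf_\lambda f_\lambda(\rho)$ and $f(\rho)=\sup_\lambda f_\lambda(\rho)$, where $\{f_\lambda\}$ is some family of functions in $L^m_n(C,D|\mathfrak{S}_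0)$.
   Formalization: In part B, when f is a supremum of functions from the class L, each function of the family (not only the supremum f) is required to be nonnegative; the claim is false otherwise, e.g. for max(S(A_1)−S(A_2),0). *)

(* Defs.v *)
From HB Require Import structures.
From mathcomp Require Import all_boot all_order all_algebra.
From mathcomp Require Import all_classical all_reals all_analysis.
From mathcomp.real_closed Require Import complex.
Set Implicit Arguments.
Unset Strict Implicit.
Unset Printing Implicit Defensive.
Import Order.TTheory GRing.Theory Num.Theory.
Local Open Scope classical_set_scope.
Local Open Scope complex_scope.
Local Open Scope ring_scope.

(* Unconditional sums of real and complex families over a set of indices; they
   are only used on absolutely summable families, where both esums below are
   finite. *)
Definition rsum (R : realType) (I : choiceType) (D : set I) (F : I -> R) : R :=
  fine (\esum_(i in D) (Num.max (F i) 0)%:E) -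
  fine (\esum_(i in D) (Num.max (- F i) 0)%:E).

Definition csum (R : realType) (I : choiceType) (D : set I) (F : I -> R[i]) :
    R[i] :=
  rsum D (fun i => complex.Re (F i)) +i* rsum D (fun i => complex.Im (F i)).

Definition sqnormc (R : realType) (z : R[i]) : R :=
  complex.Re z ^+ 2 + complex.Im z ^+ 2.

(* The Hilbert space is l^2(I), I being the index set of an orthonormal basis
   (|i>)_(i in I).  An operator A is given by its matrix A i j = <i|A|j>. *)
Definition operator (R : realType) (I : choiceType) : Type := I -> I -> R[i].

(* <x|A|x> >= 0 for every finite linear combination x of basis vectors.  These
   are dense, so for a bounded A this is positivity of A.  The order of R[i]
   makes 0 <= z mean that z is real and nonnegative. *)
Definition positive_op (R : realType) (I : choiceType) (A : operator R I) :
    Prop :=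
  forall (s : seq I) (x : I -> R[i]), uniq s ->
    0 <= \sum_(i <- s) \sum_(j <- s) (x i)^*%C * A i j * x j.

Definition op_le (R : realType) (I : choiceType) (A B : operator R I) : Prop :=
  positive_op (fun i j => B i j - A i j).

Definition op_scale (R : realType) (I : choiceType) (a : R)
    (A : operator R I) : operator R I := fun i j => a%:C * A i j.

Definition op_mix (R : realType) (I : choiceType) (p : R)
    (A B : operator R I) : operator R I :=
  fun i j => p%:C * A i j + (1 - p)%:C * B i j.

(* A positive matrix with summable diagonal is the matrix of a unique positive
   trace-class operator, whose trace is the sum of the diagonal. *)
Definition state (R : realType) (I : choiceType) (rho : operator R I) : Prop :=
  positive_op rho /\ \esum_(i in [set: I]) (complex.Re (rho i i))%:E = 1%E.

(* Trace norm, ||A||_1 = sup sum_k |<e_k|A|f_k>| over pairs of finite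
   orthonormal systems; by density the e_k and f_k can be taken to be finite
   linear combinations of basis vectors, here supported in s. *)
Definition orthonormal_in (R : realType) (I : choiceType) (s : seq I)
    (r : nat) (e : 'I_r -> I -> R[i]) : Prop :=
  forall k l : 'I_r, \sum_(i <- s) (e k i)^*%C * e l i = (k == l)%:R.

Definition trace_norm (R : realType) (I : choiceType) (A : operator R I) :
    \bar R :=
  ereal_sup [set v : \bar R |
    exists (s : seq I) (r : nat) (e f : 'I_r -> I -> R[i]),
      [/\ uniq s, orthonormal_in s e, orthonormal_in s f &
        v = (\sum_(k < r) ComplexField.Normc.normc
              (\sum_(i <- s) \sum_(j <- s) (e k i)^*%C * A i j * f k j))%:E]].

(* A = sum_k lam_k |e_k><e_k|, with (e_k) an orthonormal sequence in l^2(I) and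
   (lam_k) a nonnegative summable sequence. *)
Definition spectral_decomposition (R : realType) (I : choiceType)
    (A : operator R I) (lam : nat -> R) (e : nat -> I -> R[i]) : Prop :=
  [/\ forall k, 0 <= lam k,
      (\esum_(k in [set: nat]) (lam k)%:E < +oo)%E,
      forall k, (\esum_(i in [set: I]) (sqnormc (e k i))%:E < +oo)%E,
      forall k l, csum [set: I] (fun i => (e k i)^*%C * e l i) = (k == l)%:R &
      forall i j,
        A i j = csum [set: nat] (fun k => (lam k)%:C * e k i * (e k j)^*%C)].

(* von Neumann entropy of a state of an infinite-dimensional space:
   Tr (- rho ln rho) = sum_k - lam_k ln lam_k.  The sum is the same for all the
   spectral decompositions of rho; the supremum just picks this value.
   In MathComp-Analysis ln 0 = 0. *)
Definition entropy (R : realType) (I : choiceType) (rho : operator R I) :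
    \bar R :=
  ereal_sup [set v : \bar R | exists (lam : nat -> R) (e : nat -> I -> R[i]),
    spectral_decomposition rho lam e /\
    v = \esum_(k in [set: nat]) (- (lam k * ln (lam k)))%:E].

(* The Fock basis of n modes is |i_1> (x) ... (x) |i_n>, so that the n-mode
   space is l^2(N^n).  Modes are numbered from 0. *)
Definition fock (n : nat) : choiceType := {ffun 'I_n -> nat}.

Definition fock_set (n : nat) (i : fock n) (k : 'I_n) (b : nat) : fock n :=
  [ffun l => if l == k then b else i l].

(* Partial trace onto mode k: the entry (a, b) is the sum of
   <i|rho|j> over the pairs (i, j) with i_k = a, j_k = b and i_l = j_l for all
   l <> k. *)
Definition reduced (R : realType) (n : nat) (k : 'I_n)
    (rho : operator R (fock n)) : operator R nat :=
  fun a b => csum [set i : fock n | i k = a]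
    (fun i => rho i (fock_set i k b)).

(* C is R * R and C^n is a space of n-tuples, both with the product
   sigma-algebra, that is, the Borel one. *)
Definition Cplx (R : realType) : Type :=
  (measurableTypeR R * measurableTypeR R)%type.

Definition Cn (R : realType) (n : nat) : Type := n.-tuple (Cplx R).

Definition sqmod (R : realType) (z : Cplx R) : R := z.1 ^+ 2 + z.2 ^+ 2.

Definition coherent1 (R : realType) (z : Cplx R) (j : nat) : R[i] :=
  (expR (- (sqmod z) / 2))%:C * (z.1 +i* z.2) ^+ j /
  (Num.sqrt (j`!%:R : R))%:C.

Definition coherent (R : realType) (n : nat) (z : Cn R n) (i : fock n) : R[i] :=
  \prod_(k < n) coherent1 (tnth z k) (i k).

Definition coherent_state (R : realType) (n : nat) (z : Cn R n) :
    operator R (fock n) := fun i j => coherent z i * (coherent z j)^*%C.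

(* rho(mu), the integral being taken entry by entry. *)
Definition rho_of (R : realType) (n : nat) (mu : probability (Cn R n) R) :
    operator R (fock n) :=
  fun i j =>
    (\int[mu]_z complex.Re (coherent_state z i j)) +i*
    (\int[mu]_z complex.Im (coherent_state z i j)).

Definition coherent_hull (R : realType) (n : nat) :
    set (operator R (fock n)) :=
  [set sigma | exists (N : nat) (p : 'I_N -> R) (z : 'I_N -> Cn R n),
    [/\ forall l, 0 <= p l, \sum_(l < N) p l = 1 &
      sigma = fun i j => \sum_(l < N) (p l)%:C * coherent_state (z l) i j]].

(* Closure of the convex hull of the coherent states in the trace norm. *)
Definition classical (R : realType) (n : nat) : set (operator R (fock n)) :=
  [set rho | forall eps : R, 0 < eps ->
    exists2 sigma, coherent_hull sigma &
      (trace_norm (fun i j => rho i j - sigma i j)%R < eps%:E)%E].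

Definition marginal (R : realType) (n : nat) (mu : probability (Cn R n) R)
    (k : 'I_n) : set (Cplx R) -> \bar R :=
  pushforward mu (fun z : Cn R n => tnth z k).

(* Sum over the first m modes of the second moments of the marginals. *)
Definition energy (R : realType) (n m : nat) (mu : probability (Cn R n) R) :
    \bar R :=
  (\sum_(k < n | (k < m)%N) \int[marginal mu k]_z (sqmod z)%:E)%E.

Definition TV (R : realType) (n : nat) (mu nu : probability (Cn R n) R) :
    \bar R :=
  ereal_sup [set `|mu A - nu A|%E | A in [set A : set (Cn R n) | measurable A]].

Definition h2 (R : realType) (p : R) : R :=
  - (p * ln p) - (1 - p) * ln (1 - p).

Definition g (R : realType) (x : R) : R :=
  if 0 < x then (x + 1) * ln (x + 1) - x * ln x else 0.

Definition convex_set_of_states (R : realType) (n : nat)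
    (S0 : set (operator R (fock n))) : Prop :=
  (forall rho, S0 rho -> state rho) /\
  (forall rho sigma p, S0 rho -> S0 sigma -> 0 <= p <= 1 ->
     S0 (op_mix p rho sigma)).

Definition classically_hereditary (R : realType) (n : nat)
    (S0 : set (operator R (fock n))) : Prop :=
  forall rho, S0 rho -> classical rho ->
    [set sigma | classical sigma /\
       exists2 eps : R, 0 < eps & op_le (op_scale eps sigma) rho] `<=` S0.

Definition entropies (R : realType) (n m : nat) (rho : operator R (fock n)) :
    \bar R :=
  (\sum_(k < n | (k < m)%N) entropy (reduced k rho))%E.

(* A function S0 -> (-oo, +oo] is a total \bar R-valued function of which only
   the values on S0 are used. In \bar R, 0 * +oo = 0. *)
Definition Lclass (R : realType) (n m : nat) (C D : R)
    (S0 : set (operator R (fock n))) : set (operator R (fock n) -> \bar R) :=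
  [set f | (forall rho, S0 rho -> (-oo < f rho)%E) /\
    exists cm cp dm dp : R,
    [/\ [/\ 0 <= cm, 0 <= cp, 0 <= dm & 0 <= dp],
        cm + cp = C, dm + dp = D,
        forall rho sigma p, S0 rho -> S0 sigma -> 0 <= p <= 1 ->
          (p%:E * f rho + (1 - p)%:E * f sigma - (dm * h2 p)%:E
             <= f (op_mix p rho sigma))%E /\
          (f (op_mix p rho sigma)
             <= p%:E * f rho + (1 - p)%:E * f sigma + (dp * h2 p)%:E)%E &
        forall rho, S0 rho ->
          (- (cm%:E * entropies m rho) <= f rho)%E /\
          (f rho <= cp%:E * entropies m rho)%E]].

(* K together with the pointwise (on S0) infima and suprema of the nonempty
   families of members of K. *)
Definition inf_sup_extension (R : realType) (T : Type) (S0 : set T)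
    (K : set (T -> \bar R)) : set (T -> \bar R) :=
  [set f | K f \/ exists F : set (T -> \bar R),
    [/\ F !=set0, F `<=` K &
      (forall rho, S0 rho -> f rho = ereal_inf [set h rho | h in F]) \/
      (forall rho, S0 rho -> f rho = ereal_sup [set h rho | h in F])]].

Definition Lhat (R : realType) (n m : nat) (C D : R)
    (S0 : set (operator R (fock n))) : set (operator R (fock n) -> \bar R) :=
  inf_sup_extension S0 (Lclass m C D S0).

(* The nonnegative functions of Lhat: the same extension, starting from the
   nonnegative members of Lclass.  Members of Lclass and infima are nonnegative
   exactly when they are obtained in this way.  For suprema, nonnegativity is
   required of the members of the family, not only of the supremum: with
   S0 = {rho : S(rho_A1), S(rho_A2) < +oo}, the function
   max (S(rho_A1) - S(rho_A2), 0) is a nonnegative supremum of members of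
   Lclass 2 2 2 S0, but the one-sided continuity bound fails for it. *)
Definition Lhat_ge0 (R : realType) (n m : nat) (C D : R)
    (S0 : set (operator R (fock n))) : set (operator R (fock n) -> \bar R) :=
  inf_sup_extension S0
    [set f | Lclass m C D S0 f /\ forall rho, S0 rho -> (0 <= f rho)%E].

(* Main.v *)
(* Let del^+ and del^- be the Jordan parts of mu - nu (mass t <= eps each) and
   tau^+-, their normalizations.  The state
     (rho(mu) + t rho(tau^-)) / (1 + t) = (rho(nu) + t rho(tau^+)) / (1 + t)
   is a mixture in two ways, and the quasi-convexity bounds for p = 1 / (1 + t)
   give
     f(rho(mu)) - f(rho(nu)) <= t (f(rho(tau^+)) - f(rho(tau^-))) + D g(t),
   as (1 + t) h2(p) = g(t).  Since t rho(tau^+-) is below rho(mu), resp. rho(nu),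
   these two states are in S0.  Gibbs' inequality against thermal states bounds
   their entropies in terms of the energy, t E(tau^+) <= E(mu) being at most m E.
   The same thermal state is used for all modes, and is optimized at the end:
   this avoids both the concavity of g and the monotonicity of x g(E / x). *)

Require Import Defs.
From HB Require Import structures.
From mathcomp Require Import all_boot all_order all_algebra.
From mathcomp Require Import all_classical all_reals all_analysis.
From mathcomp.real_closed Require Import complex.
From mathcomp Require Import measurable_realfun ring lra.
Set Implicit Arguments.
Unset Strict Implicit.
Unset Printing Implicit Defensive.
Import Order.TTheory GRing.Theory Num.Theory.
Import numFieldNormedType.Exports.
Local Open Scope classical_set_scope.
Local Open Scope ring_scope.
Local Open Scope complex_scope.

(** * Finite sums of complex numbers *)

(** Heredity of [S0] speaks of [classical] states, that is, of trace-norm limits of finite mixtures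
    of coherent states, whereas [rho_of] is an entrywise integral. So every [rho_of] must first be
    approximated by finite mixtures; the trace norm being a supremum of pairings with orthonormal
    systems, this needs a bound on the pairings that is uniform in these systems. The domination of
    t rho(tau^+-) is the positivity of the integral over the part common to mu and nu. The constants
    add up as follows: the entropy of tau^+ is paid with c^+ and that of tau^- with c^-, which gives
    C; the two mixture inequalities cost d^- and d^+, which gives D. In B the value at rho(tau^-) is
    bounded below by 0, which takes the place of the energy bound on nu. *)

Lemma sqnormc_ge0 {R : realType} (z : R[i]) : 0 <= sqnormc z.
Proof. by rewrite addr_ge0 ?sqr_ge0. Qed.

Lemma sqnormcE {R : realType} (z : R[i]) : z^*%C * z = (sqnormc z)%:C.
Proof.
case: z => a b; apply/eqP; rewrite eq_complex /sqnormc /=; apply/andP; split;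
  apply/eqP; ring.
Qed.

Lemma sqnormcM {R : realType} (z w : R[i]) :
  sqnormc (z * w) = sqnormc z * sqnormc w.
Proof. by case: z w => [a b] [c d]; rewrite /sqnormc /=; ring. Qed.

Lemma sqnormcJ {R : realType} (z : R[i]) : sqnormc z^*%C = sqnormc z.
Proof. by case: z => a b; rewrite /sqnormc /=; ring. Qed.

Lemma sqnormc_prod {R : realType} (I : Type) (s : seq I) (F : I -> R[i]) :
  sqnormc (\prod_(i <- s) F i) = \prod_(i <- s) sqnormc (F i).
Proof.
apply: (big_morph (@sqnormc R)); first exact: sqnormcM.
by rewrite /sqnormc /=; ring.
Qed.

Lemma sqnormcB_le {R : realType} (z w : R[i]) :
  sqnormc (z - w) <= 2 * sqnormc z + 2 * sqnormc w.
Proof.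
case: z w => [a b] [c d]; rewrite /sqnormc /=.
have : 0 <= (a + c) ^+ 2 + (b + d) ^+ 2 by rewrite addr_ge0 ?sqr_ge0.
nra.
Qed.

Lemma conjcM {R : realType} (z w : R[i]) : (z * w)^*%C = z^*%C * w^*%C.
Proof. exact: rmorphM. Qed.

Lemma conjcB {R : realType} (z w : R[i]) : (z - w)^*%C = z^*%C - w^*%C.
Proof. exact: rmorphB. Qed.

Lemma conjc_sum {R : realType} (I : Type) (s : seq I) (F : I -> R[i]) :
  (\sum_(i <- s) F i)^*%C = \sum_(i <- s) (F i)^*%C.
Proof. exact: rmorph_sum. Qed.

Lemma Re_add {R : realType} (z w : R[i]) :
  complex.Re (z + w) = complex.Re z + complex.Re w.
Proof. by case: z w => [? ?] [? ?]. Qed.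

Lemma Im_add {R : realType} (z w : R[i]) :
  complex.Im (z + w) = complex.Im z + complex.Im w.
Proof. by case: z w => [? ?] [? ?]. Qed.

Lemma Re_mul {R : realType} (z w : R[i]) :
  complex.Re (z * w) =
  complex.Re z * complex.Re w - complex.Im z * complex.Im w.
Proof. by case: z w => [? ?] [? ?]. Qed.

Lemma Im_mul {R : realType} (z w : R[i]) :
  complex.Im (z * w) =
  complex.Re z * complex.Im w + complex.Im z * complex.Re w.
Proof. by case: z w => [? ?] [? ?]. Qed.

Lemma Re_sum {R : realType} (I : Type) (s : seq I) (P : pred I) (F : I -> R[i]) :
  complex.Re (\sum_(i <- s | P i) F i) = \sum_(i <- s | P i) complex.Re (F i).
Proof. by apply: (big_morph (@complex.Re R)); first exact: Re_add. Qed.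

Lemma Im_sum {R : realType} (I : Type) (s : seq I) (P : pred I) (F : I -> R[i]) :
  complex.Im (\sum_(i <- s | P i) F i) = \sum_(i <- s | P i) complex.Im (F i).
Proof. by apply: (big_morph (@complex.Im R)); first exact: Im_add. Qed.

Lemma Re_sqr_le {R : realType} (z : R[i]) : complex.Re z ^+ 2 <= sqnormc z.
Proof. by rewrite lerDl sqr_ge0. Qed.

Lemma Im_sqr_le {R : realType} (z : R[i]) : complex.Im z ^+ 2 <= sqnormc z.
Proof. by rewrite lerDr sqr_ge0. Qed.

Lemma sqr_le1_norm {R : realType} (x : R) : x ^+ 2 <= 1 -> `|x| <= 1.
Proof. by rewrite -[leLHS]real_normK ?num_real// expr_le1. Qed.

Lemma norm_Re_le1 {R : realType} (z : R[i]) :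
  sqnormc z <= 1 -> `|complex.Re z| <= 1.
Proof. by move=> z1; apply/sqr_le1_norm/(le_trans (Re_sqr_le z)). Qed.

Lemma norm_Im_le1 {R : realType} (z : R[i]) :
  sqnormc z <= 1 -> `|complex.Im z| <= 1.
Proof. by move=> z1; apply/sqr_le1_norm/(le_trans (Im_sqr_le z)). Qed.

(* Expansion of 0 <= |x - sum_k b_k e_k|^2 with b_k = <e_k|x>, for a family
   (e_k) that need not be orthonormal on s. *)
Lemma gram_bessel {R : realType} (I : Type) (s : seq I) (r : nat)
    (e : 'I_r -> I -> R[i]) (x : I -> R[i]) (b : 'I_r -> R[i]) :
  (forall k, b k = \sum_(i <- s) (e k i)^*%C * x i) ->
  2 * \sum_(k < r) sqnormc (b k) <= \sum_(i <- s) sqnormc (x i) +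
    complex.Re (\sum_(k < r) \sum_(l < r)
      (b k)^*%C * b l * \sum_(i <- s) (e k i)^*%C * e l i).
Proof.
move=> bE.
have bJ k : (b k)^*%C = \sum_(i <- s) e k i * (x i)^*%C.
  rewrite bE conjc_sum; apply: eq_bigr => i _.
  by rewrite conjcM conjcK.
have : 0 <= \sum_(i <- s) sqnormc (x i - \sum_(k < r) b k * e k i).
  by apply: sumr_ge0 => i _; exact: sqnormc_ge0.
suff -> : \sum_(i <- s) sqnormc (x i - \sum_(k < r) b k * e k i) =
    \sum_(i <- s) sqnormc (x i) - 2 * \sum_(k < r) sqnormc (b k) +
    complex.Re (\sum_(k < r) \sum_(l < r)
      (b k)^*%C * b l * \sum_(i <- s) (e k i)^*%C * e l i) by lra.
have sqE (z : R[i]) : sqnormc z = complex.Re (z^*%C * z) by rewrite sqnormcE.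
under eq_bigr do rewrite sqE.
under [\sum_(i <- s) sqnormc _]eq_bigr do rewrite sqE.
under [\sum_(i < r) sqnormc _]eq_bigr do rewrite sqE.
rewrite -!Re_sum.
have -> (z w : R[i]) : complex.Re z - 2 * complex.Re w = complex.Re (z - 2 * w).
  by case: z w => [? ?] [? ?] /=; ring.
rewrite -Re_add; congr complex.Re.
have -> : \sum_(i <- s) (x i - \sum_(k < r) b k * e k i)^*%C *
    (x i - \sum_(k < r) b k * e k i) =
  \sum_(i <- s) (x i)^*%C * x i
  - \sum_(i <- s) (\sum_(k < r) b k * e k i) * (x i)^*%C
  - \sum_(i <- s) (\sum_(k < r) b k * e k i)^*%C * x i
  + \sum_(i <- s) (\sum_(k < r) b k * e k i)^*%C * (\sum_(k < r) b k * e k i).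
  rewrite -!sumrB -big_split; apply: eq_bigr => i _ /=.
  rewrite conjcB /=; ring.
have -> : \sum_(i <- s) (\sum_(k < r) b k * e k i) * (x i)^*%C =
    \sum_(k < r) (b k)^*%C * b k.
  under eq_bigr do rewrite mulr_suml.
  rewrite exchange_big /=; apply: eq_bigr => k _.
  rewrite bJ mulrC mulr_sumr; apply: eq_bigr => i _; ring.
have -> : \sum_(i <- s) (\sum_(k < r) b k * e k i)^*%C * x i =
    \sum_(k < r) (b k)^*%C * b k.
  under eq_bigr do rewrite conjc_sum mulr_suml.
  rewrite exchange_big /=; apply: eq_bigr => k _.
  rewrite [X in _ = _ * X]bE mulr_sumr; apply: eq_bigr => i _.
  by rewrite conjcM mulrA.
have -> : \sum_(i <- s) (\sum_(k < r) b k * e k i)^*%C * (\sum_(k < r) b k * e k i)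
  = \sum_(k < r) \sum_(l < r)
      (b k)^*%C * b l * \sum_(i <- s) (e k i)^*%C * e l i.
  under eq_bigr do rewrite conjc_sum mulr_suml.
  rewrite exchange_big /=; apply: eq_bigr => k _.
  under eq_bigr do rewrite mulr_sumr.
  rewrite exchange_big /=; apply: eq_bigr => l _.
  rewrite mulr_sumr; apply: eq_bigr => i _.
  rewrite conjcM /=; ring.
ring.
Qed.

Lemma bessel {R : realType} (I : choiceType) (s : seq I) (r : nat)
    (e : 'I_r -> I -> R[i]) (x : I -> R[i]) : orthonormal_in s e ->
  \sum_(k < r) sqnormc (\sum_(i <- s) (e k i)^*%C * x i) <=
    \sum_(i <- s) sqnormc (x i).
Proof.
move=> eO.
pose b k := \sum_(i <- s) (e k i)^*%C * x i.
have := @gram_bessel _ _ s _ e x b (fun=> erefl).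
have -> : \sum_(k < r) \sum_(l < r)
    (b k)^*%C * b l * \sum_(i <- s) (e k i)^*%C * e l i =
  \sum_(k < r) (sqnormc (b k))%:C.
  apply: eq_bigr => k _; rewrite (bigD1 k) //= [X in _ + X]big1 ?addr0 => [|l lk].
    by rewrite eO eqxx mulr1 sqnormcE.
  by rewrite eO eq_sym (negbTE lk) mulr0.
rewrite Re_sum /=; lra.
Qed.

(** Weighted arithmetic-geometric mean inequality. Squares appear on the right, so that the bound
    can be summed over an orthonormal system by Bessel before [eta] is chosen. *)
Lemma Re_phaseM_le {R : realType} (u a b : R[i]) (eta : R) : 0 < eta ->
  sqnormc u <= 1 ->
  complex.Re (u * (a * b)) <= (sqnormc a / eta + eta * sqnormc b) / 2.
Proof.
move=> eta0 u1.
set k := Num.sqrt eta.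
have k0 : 0 < k by rewrite sqrtr_gt0.
have kE : eta = k ^+ 2 by rewrite sqr_sqrtr // ltW.
rewrite kE; set c := u * a.
have -> : u * (a * b) = c * b by rewrite mulrA.
apply: (@le_trans _ _ ((sqnormc c / k ^+ 2 + k ^+ 2 * sqnormc b) / 2)).
  case: c b => [c c'] [b b']; rewrite /sqnormc /=.
  (* Squared modulus of c / k minus k times the conjugate of b, where k^2 = [eta]. *)
  have : 0 <= (c / k - k * b) ^+ 2 + (c' / k + k * b') ^+ 2.
    by rewrite addr_ge0 ?sqr_ge0.
  suff -> : (c / k - k * b) ^+ 2 + (c' / k + k * b') ^+ 2 =
    (c ^+ 2 + c' ^+ 2) / k ^+ 2 + k ^+ 2 * (b ^+ 2 + b' ^+ 2) -
    2 * (c * b - c' * b') by lra.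
  by field; rewrite gt_eqF.
rewrite ler_pM2r ?invr_gt0// lerD2r ler_pM2r ?invr_gt0 ?exprn_gt0//.
by rewrite /c sqnormcM ler_piMl ?sqnormc_ge0.
Qed.

(** With d = psi - phi, |psi><psi| - |phi><phi| = |d><psi| + |phi><d|. Each term is split by the
    weighted mean inequality and summed by Bessel. The result depends neither on the orthonormal
    systems nor on the phases [u], so it can be integrated over a family of vectors. *)
Lemma pairing_rank_one_le {R : realType} (I : choiceType) (s : seq I) (r : nat)
    (e f : 'I_r -> I -> R[i]) (u : 'I_r -> R[i]) (psi phi : I -> R[i])
    (eta : R) : 0 < eta -> orthonormal_in s e -> orthonormal_in s f ->
  (forall k, sqnormc (u k) <= 1) ->
  \sum_(i <- s) sqnormc (psi i) <= 1 -> \sum_(i <- s) sqnormc (phi i) <= 1 ->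
  complex.Re (\sum_(k < r) u k * \sum_(i <- s) \sum_(j <- s) (e k i)^*%C *
     (psi i * (psi j)^*%C - phi i * (phi j)^*%C) * f k j) <=
  (\sum_(i <- s) sqnormc (psi i - phi i)) / eta + eta.
Proof.
move=> eta0 eO fO u1 psi1 phi1.
pose be k (x : I -> R[i]) := \sum_(i <- s) (e k i)^*%C * x i.
pose bf k (x : I -> R[i]) := \sum_(i <- s) (f k i)^*%C * x i.
pose d i := psi i - phi i.
have bfJ k x : (bf k x)^*%C = \sum_(j <- s) (x j)^*%C * f k j.
  rewrite /bf conjc_sum; apply: eq_bigr => j _.
  by rewrite conjcM conjcK mulrC.
have pairE k : \sum_(i <- s) \sum_(j <- s) (e k i)^*%C *
     (psi i * (psi j)^*%C - phi i * (phi j)^*%C) * f k j =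
    be k d * (bf k psi)^*%C + be k phi * (bf k d)^*%C.
  rewrite !bfJ /be !mulr_suml -big_split; apply: eq_bigr => i _ /=.
  rewrite !mulr_sumr -big_split; apply: eq_bigr => j _ /=.
  rewrite /d conjcB /=; ring.
set Q := \sum_(i <- s) sqnormc (psi i - phi i).
under eq_bigr do rewrite pairE mulrDr.
rewrite Re_sum.
apply: (@le_trans _ _ (\sum_(k < r) (
   (sqnormc (be k d) / eta + eta * sqnormc (bf k psi)) / 2 +
   (sqnormc (bf k d) / eta + eta * sqnormc (be k phi)) / 2))).
  apply: ler_sum => k _; rewrite Re_add; apply: lerD.
    by rewrite -(sqnormcJ (bf k psi)); exact: Re_phaseM_le.
  by rewrite -(sqnormcJ (bf k d)) [be k phi * _]mulrC; exact: Re_phaseM_le.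
rewrite big_split /= -!mulr_suml !big_split /= -!mulr_suml -!mulr_sumr.
have Bd1 : \sum_(k < r) sqnormc (be k d) <= Q.
  exact: bessel.
have Bd2 : \sum_(k < r) sqnormc (bf k d) <= Q.
  exact: bessel.
have Bpsi : \sum_(k < r) sqnormc (bf k psi) <= 1.
  exact: le_trans (@bessel _ _ _ _ _ psi fO) psi1.
have Bphi : \sum_(k < r) sqnormc (be k phi) <= 1.
  exact: le_trans (@bessel _ _ _ _ _ phi eO) phi1.
have Bd1' : (\sum_(k < r) sqnormc (be k d)) / eta <=
    Q / eta by rewrite ler_pM2r ?invr_gt0.
have Bd2' : (\sum_(k < r) sqnormc (bf k d)) / eta <=
    Q / eta by rewrite ler_pM2r ?invr_gt0.
have Bpsi' : eta * (\sum_(k < r) sqnormc (bf k psi)) <= eta.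
  by rewrite ler_piMr// ltW.
have Bphi' : eta * (\sum_(k < r) sqnormc (be k phi)) <= eta.
  by rewrite ler_piMr// ltW.
move: Bd1' Bd2' Bpsi' Bphi'.
set q1 := _ / eta; set q2 := _ / eta; set q3 := _ / eta; set q4 := eta * _.
set q5 := eta * _.
lra.
Qed.

(** * Integrals of bounded functions *)

(** Stronger than integrability, but stable under products and independent of the finite measure;
    the entries of coherent states satisfy it. *)
Definition bounded_meas {d} {T : measurableType d} {R : realType} (f : T -> R) :
    Prop :=
  measurable_fun setT f /\ exists M : R, forall z, `|f z| <= M.

Lemma bounded_meas_integrable {d} {T : measurableType d} {R : realType}
    (mu : {finite_measure set T -> \bar R}) (f : T -> R) :
  bounded_meas f -> mu.-integrable setT (EFin \o f).
Proof.
move=> [mf [M fM]]; apply: measurable_bounded_integrable => //.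
  by rewrite -ge0_fin_numE// fin_num_measure.
exists M; split; first by rewrite num_real.
by move=> x Mx z _; exact: le_trans (fM z) (ltW Mx).
Qed.

Lemma bounded_meas_cst {d} {T : measurableType d} {R : realType} (a : R) :
  bounded_meas (fun _ : T => a).
Proof. by split; [exact: measurable_cst | exists `|a|]. Qed.

Lemma bounded_measD {d} {T : measurableType d} {R : realType} (f h : T -> R) :
  bounded_meas f -> bounded_meas h -> bounded_meas (fun z => f z + h z).
Proof.
move=> [mf [M fM]] [mh [N hN]]; split; first exact: measurable_funD.
by exists (M + N) => z; rewrite (le_trans (ler_normD _ _))// lerD.
Qed.

Lemma bounded_measM {d} {T : measurableType d} {R : realType} (f h : T -> R) :
  bounded_meas f -> bounded_meas h -> bounded_meas (fun z => f z * h z).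
Proof.
move=> [mf [M fM]] [mh [N hN]]; split; first exact: measurable_funM.
by exists (M * N) => z; rewrite normrM ler_pM.
Qed.

Lemma bounded_measZ {d} {T : measurableType d} {R : realType} (a : R)
    (f : T -> R) : bounded_meas f -> bounded_meas (fun z => a * f z).
Proof. by move=> bf; apply: bounded_measM => //; exact: bounded_meas_cst. Qed.

Lemma bounded_measB {d} {T : measurableType d} {R : realType} (f h : T -> R) :
  bounded_meas f -> bounded_meas h -> bounded_meas (fun z => f z - h z).
Proof.
move=> bf bh; have := bounded_measD bf (bounded_measZ (-1) bh).
by congr bounded_meas; apply/funext => z /=; rewrite mulN1r.
Qed.

Lemma bounded_meas_sum {d} {T : measurableType d} {R : realType} (I : Type)
    (s : seq I) (F : I -> T -> R) :
  (forall i, bounded_meas (F i)) -> bounded_meas (fun z => \sum_(i <- s) F i z).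
Proof.
move=> bF; elim: s => [|i s IHs].
  have := @bounded_meas_cst _ T R 0.
  by congr bounded_meas; apply/funext => z; rewrite big_nil.
have := bounded_measD (bF i) IHs.
by congr bounded_meas; apply/funext => z; rewrite big_cons.
Qed.

Lemma Rintegral_sum {d} {T : measurableType d} {R : realType}
    (mu : {finite_measure set T -> \bar R}) (I : Type) (s : seq I)
    (F : I -> T -> R) : (forall i, bounded_meas (F i)) ->
  (\int[mu]_z \sum_(i <- s) F i z = \sum_(i <- s) \int[mu]_z F i z)%R.
Proof.
move=> bF; elim: s => [|i s IHs].
  rewrite big_nil -[RHS](mul0r (fine (mu setT))) -Rintegral_cst//.
  by apply: eq_Rintegral => z _; rewrite big_nil.
rewrite big_cons -IHs -RintegralD//.
- by apply: eq_Rintegral => z _; rewrite big_cons.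
- exact: bounded_meas_integrable.
- exact/bounded_meas_integrable/bounded_meas_sum.
Qed.

Definition cbounded_meas {d} {T : measurableType d} {R : realType}
    (F : T -> R[i]) : Prop :=
  bounded_meas (fun z => complex.Re (F z)) /\
  bounded_meas (fun z => complex.Im (F z)).

Lemma cbounded_meas_cst {d} {T : measurableType d} {R : realType} (a : R[i]) :
  cbounded_meas (fun _ : T => a).
Proof. by split; exact: bounded_meas_cst. Qed.

Lemma cbounded_measD {d} {T : measurableType d} {R : realType}
    (F G : T -> R[i]) : cbounded_meas F -> cbounded_meas G ->
  cbounded_meas (fun z => F z + G z).
Proof.
move=> [rF iF] [rG iG]; split.
  by under eq_fun do rewrite Re_add; exact: bounded_measD.
by under eq_fun do rewrite Im_add; exact: bounded_measD.
Qed.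

Lemma cbounded_measM {d} {T : measurableType d} {R : realType}
    (F G : T -> R[i]) : cbounded_meas F -> cbounded_meas G ->
  cbounded_meas (fun z => F z * G z).
Proof.
move=> [rF iF] [rG iG]; split.
  under eq_fun do rewrite Re_mul.
  by apply: bounded_measB; apply: bounded_measM.
under eq_fun do rewrite Im_mul.
by apply: bounded_measD; apply: bounded_measM.
Qed.

Lemma cbounded_measB {d} {T : measurableType d} {R : realType}
    (F G : T -> R[i]) : cbounded_meas F -> cbounded_meas G ->
  cbounded_meas (fun z => F z - G z).
Proof.
move=> bF bG.
have := cbounded_measD bF (cbounded_measM (cbounded_meas_cst (-1)) bG).
by congr cbounded_meas; apply/funext => z; rewrite mulN1r.
Qed.

Lemma cbounded_measJ {d} {T : measurableType d} {R : realType}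
    (F : T -> R[i]) : cbounded_meas F -> cbounded_meas (fun z => (F z)^*%C).
Proof.
move=> [rF iF]; split.
  by have := rF; congr bounded_meas; apply/funext => z; case: (F z).
have := bounded_measZ (-1) iF; congr bounded_meas; apply/funext => z.
by case: (F z) => a b /=; rewrite mulN1r.
Qed.

Lemma cbounded_meas_sum {d} {T : measurableType d} {R : realType} (I : Type)
    (s : seq I) (F : I -> T -> R[i]) :
  (forall i, cbounded_meas (F i)) ->
  cbounded_meas (fun z => \sum_(i <- s) F i z).
Proof.
move=> bF; split.
  under eq_fun do rewrite Re_sum.
  by apply: bounded_meas_sum => i; have [] := bF i.
under eq_fun do rewrite Im_sum.
by apply: bounded_meas_sum => i; have [] := bF i.
Qed.

Lemma cbounded_meas_sqnormc {d} {T : measurableType d} {R : realType}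
    (F : T -> R[i]) : cbounded_meas F -> bounded_meas (fun z => sqnormc (F z)).
Proof.
by move=> [rF iF]; apply: bounded_measD; under eq_fun do rewrite expr2;
  exact: bounded_measM.
Qed.

(** [rho_of mu i j] is convertible to such an integral; here the measure may also be the common part
    of two probabilities, of mass less than 1. *)
Definition cint {d} {T : measurableType d} {R : realType}
    (mu : {measure set T -> \bar R}) (F : T -> R[i]) : R[i] :=
  (\int[mu]_z complex.Re (F z)) +i* (\int[mu]_z complex.Im (F z)).

Lemma eq_cint {d} {T : measurableType d} {R : realType}
    (mu : {measure set T -> \bar R}) (F G : T -> R[i]) :
  F =1 G -> cint mu F = cint mu G.
Proof. by move=> /funext ->. Qed.

Lemma cint_sum {d} {T : measurableType d} {R : realType}
    (mu : {finite_measure set T -> \bar R}) (I : Type) (s : seq I)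
    (F : I -> T -> R[i]) : (forall i, cbounded_meas (F i)) ->
  cint mu (fun z => \sum_(i <- s) F i z) = \sum_(i <- s) cint mu (F i).
Proof.
move=> bF; apply/eqP; rewrite eq_complex Re_sum Im_sum /cint /=.
apply/andP; split; apply/eqP; rewrite -Rintegral_sum => [|i].
- by apply: eq_Rintegral => z _; rewrite Re_sum.
- by have [] := bF i.
- by apply: eq_Rintegral => z _; rewrite Im_sum.
- by have [] := bF i.
Qed.

Lemma cintZ {d} {T : measurableType d} {R : realType}
    (mu : {finite_measure set T -> \bar R}) (a : R[i]) (F : T -> R[i]) :
  cbounded_meas F -> cint mu (fun z => a * F z) = a * cint mu F.
Proof.
move=> [rF iF]; apply/eqP; rewrite eq_complex Re_mul Im_mul /cint /=.
apply/andP; split; apply/eqP.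
  rewrite -!RintegralZl//; try exact: bounded_meas_integrable.
  rewrite -RintegralB//; try exact/bounded_meas_integrable/bounded_measZ.
  by apply: eq_Rintegral => z _; rewrite Re_mul.
rewrite -!RintegralZl//; try exact: bounded_meas_integrable.
rewrite -RintegralD//; try exact/bounded_meas_integrable/bounded_measZ.
by apply: eq_Rintegral => z _; rewrite Im_mul.
Qed.

Lemma cintB {d} {T : measurableType d} {R : realType}
    (mu : {finite_measure set T -> \bar R}) (F G : T -> R[i]) :
  cbounded_meas F -> cbounded_meas G ->
  cint mu F - cint mu G = cint mu (fun z => F z - G z).
Proof.
move=> [rF iF] [rG iG]; apply/eqP; rewrite eq_complex /cint /=.
have ReB (z w : R[i]) : complex.Re (z - w) = complex.Re z - complex.Re w.
  by case: z w => [? ?] [? ?].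
have ImB (z w : R[i]) : complex.Im (z - w) = complex.Im z - complex.Im w.
  by case: z w => [? ?] [? ?].
apply/andP; split; apply/eqP; rewrite -RintegralB//;
  try exact: bounded_meas_integrable; apply: eq_Rintegral => z _.
  by rewrite ReB.
by rewrite ImB.
Qed.

(** [kap] stands for the part common to two probabilities, and [t] times [tau] for a Jordan part of
    their difference. *)
Definition measure_split {d} {T : measurableType d} {R : realType}
    (mu kap tau : set T -> \bar R) (t : R) : Prop :=
  forall A, measurable A -> mu A = (kap A + t%:E * tau A)%E.

Lemma ge0_integral_split {d} {T : measurableType d} {R : realType}
    (mu kap tau : {measure set T -> \bar R}) (t : R) (f : T -> \bar R) :
  0 <= t -> measure_split mu kap tau t -> measurable_fun setT f ->
  (forall z, 0 <= f z)%E ->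
  (\int[mu]_z f z = \int[kap]_z f z + t%:E * \int[tau]_z f z)%E.
Proof.
move=> t0 mukt mf f0; pose tt := NngNum t0.
rewrite (eq_measure_integral (measure_add kap (mscale tt tau))) => [|A mA _].
  by rewrite ge0_integral_measure_add// ge0_integral_mscale.
by rewrite mukt//; exact: (esym (measure_addE kap (mscale tt tau) A)).
Qed.

Lemma Rintegral_split {d} {T : measurableType d} {R : realType}
    (mu kap tau : {finite_measure set T -> \bar R}) (t : R) (f : T -> R) :
  0 <= t -> measure_split mu kap tau t -> bounded_meas f ->
  (\int[mu]_z f z = \int[kap]_z f z + t * \int[tau]_z f z)%R.
Proof.
move=> t0 mukt bf; have [mf [M fM]] := bf.
have bM : bounded_meas (fun _ : T => M) by exact: bounded_meas_cst.
(* Shifting f by its bound M reduces the signed case to the nonnegative one; the measures are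
   finite, so the shift can be subtracted again. *)
have ffin (m : {finite_measure set T -> \bar R}) :
    \int[m]_z f z = \int[m]_z (f z + M) - M * fine (m setT).
  rewrite -Rintegral_cst// RintegralD//; try exact: bounded_meas_integrable.
  by rewrite addrK.
have fM0 z : 0 <= f z + M.
  by rewrite -lerBlDr sub0r; have := fM z; rewrite ler_norml => /andP[].
have intfin (m : {finite_measure set T -> \bar R}) :
    (\int[m]_z (f z + M)%:E)%E \is a fin_num.
  apply: integrable_fin_num => //.
  exact: (bounded_meas_integrable m (bounded_measD bf bM)).
rewrite !ffin /Rintegral (ge0_integral_split t0 mukt); last 2 first.
- by apply/measurable_EFinP; have [] := bounded_measD bf bM.
- by move=> z; rewrite lee_fin.
rewrite mukt//.
have tint := intfin tau; have kint := intfin kap.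
have kT := fin_num_measure kap setT measurableT.
have tT := fin_num_measure tau setT measurableT.
rewrite -(fineK tint) -(fineK kint) -(fineK kT) -(fineK tT) /=; ring.
Qed.

Lemma cint_split {d} {T : measurableType d} {R : realType}
    (mu kap tau : {finite_measure set T -> \bar R}) (t : R) (F : T -> R[i]) :
  0 <= t -> measure_split mu kap tau t -> cbounded_meas F ->
  cint mu F = cint kap F + t%:C * cint tau F.
Proof.
move=> t0 mukt [rF iF]; rewrite /cint.
rewrite (Rintegral_split t0 mukt rF) (Rintegral_split t0 mukt iF).
by apply/eqP; rewrite eq_complex /=; apply/andP; split; apply/eqP; ring.
Qed.

(** * Trace-norm approximation of mixtures *)

(** Take u = v^* / |v|, or 0 if v = 0. This makes the moduli in the trace norm linear, so that they
    can be moved inside an integral. *)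
Lemma phase_exists {R : realType} (v : R[i]) : exists u : R[i],
  sqnormc u <= 1 /\ ComplexField.Normc.normc v = complex.Re (u * v).
Proof.
case: v => a b /=; set q := a ^+ 2 + b ^+ 2.
have q0 : 0 <= q by rewrite addr_ge0 ?sqr_ge0.
have [q00|qn0] := eqVneq q 0.
  exists 0; split; first by rewrite /sqnormc /= expr0n addr0.
  by rewrite q00 sqrtr0 Re_mul /= !mul0r subr0.
set k := Num.sqrt q.
have k0 : 0 < k by rewrite sqrtr_gt0 lt_def qn0.
have kE : q = k ^+ 2 by rewrite sqr_sqrtr.
exists ((a / k) +i* (- b / k)); split.
  rewrite /sqnormc /=; suff -> : (a / k) ^+ 2 + (- b / k) ^+ 2 = 1 by [].
  have -> : (a / k) ^+ 2 + (- b / k) ^+ 2 = q / k ^+ 2.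
    by rewrite /q; field; rewrite gt_eqF.
  by rewrite kE divff// sqrf_eq0 gt_eqF.
rewrite Re_mul /=; have -> : a / k * a - - b / k * b = q / k.
  by rewrite /q; field; rewrite gt_eqF.
by rewrite kE; field; rewrite gt_eqF.
Qed.

(** The cells are the level sets of the integer part of (f + M) / del, which takes finitely many
    values because |f| <= M. *)
Lemma bounded_meas_quantize {d} {T : measurableType d} {R : realType}
    (f : T -> R) (del : R) : bounded_meas f -> 0 < del ->
  exists (N : nat) (q : T -> 'I_N),
    (forall v, measurable (q @^-1` [set v])) /\
    forall z w, q z = q w -> `|f z - f w| <= del.
Proof.
move=> [mf [M fM]] del0.
pose h z := (f z + M) / del.
have h0 z : 0 <= h z.
  rewrite divr_ge0 ?(ltW del0)// -lerBlDr sub0r.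
  by have := fM z; rewrite ler_norml => /andP[].
have mh : measurable_fun setT h.
  by apply: measurable_funM => //; exact: measurable_funD.
pose N := (Num.truncn ((M + M) / del)).+1.
have hN z : (Num.truncn (h z) < N)%N.
  rewrite ltnS; apply: le_truncn; rewrite ler_pM2r ?invr_gt0// lerD2r.
  by have := fM z; rewrite ler_norml => /andP[].
exists N, (fun z => Ordinal (hN z)); split=> [v|z w /(congr1 val) /= zw].
  rewrite (_ : _ @^-1` _ = setT `&` h @^-1` `[(v : nat)%:R, (v.+1)%:R[%classic).
    exact: mh.
  apply/seteqP; split=> z /=.
    by move=> <- /=; split=> //; rewrite in_itv /= truncn_itv.
  move=> [_]; rewrite in_itv /= => vz; apply/val_inj => /=.
  exact: truncn_def.
have := truncn_itv (h0 z); have := truncn_itv (h0 w).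
rewrite zw => /andP[w1 w2] /andP[z1 z2].
have -> : f z - f w = (h z - h w) * del by rewrite /h; field; rewrite gt_eqF.
rewrite normrM (gtr0_norm del0) ler_piMl ?(ltW del0)// ler_norml.
rewrite -addn1 natrD in w2 z2.
by apply/andP; split; lra.
Qed.

(** Common refinement of the partitions of the individual functions: a cell is coded by the rank of
    a pair of cells. *)
Lemma bounded_meas_quantize_seq {d} {T : measurableType d} {R : realType}
    (I : eqType) (s : seq I) (F : I -> T -> R) (del : R) :
  (forall i, bounded_meas (F i)) -> 0 < del ->
  exists (N : nat) (q : T -> 'I_N),
    (forall v, measurable (q @^-1` [set v])) /\
    forall z w, q z = q w -> forall i, i \in s -> `|F i z - F i w| <= del.
Proof.
move=> bF del0; elim: s => [|i s [N [q [mq qs]]]].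
  exists 1%N, (fun=> ord0); split=> // v; rewrite (_ : _ @^-1` _ = setT)//.
  by apply/seteqP; split=> z //= _; rewrite [v]ord1.
have [N' [q' [mq' qi]]] := bounded_meas_quantize (bF i) del0.
exists #|{: 'I_N' * 'I_N}|, (fun z => enum_rank (q' z, q z)); split=> [v|z w].
  rewrite (_ : _ @^-1` _ = q' @^-1` [set (enum_val v).1] `&`
                           q @^-1` [set (enum_val v).2]).
    exact: measurableI.
  apply/seteqP; split=> z /=; first by move=> <-; rewrite enum_rankK.
  by move=> [-> ->]; rewrite -surjective_pairing enum_valK.
move=> /enum_rank_inj [q'zw qzw] j; rewrite inE => /predU1P[->|js].
  exact: qi.
exact: qs.
Qed.

Lemma Rintegral_quantized {d} {T : measurableType d} {R : realType}
    (mu : {finite_measure set T -> \bar R}) (N : nat) (q : T -> 'I_N)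
    (h : 'I_N -> R) : (forall v, measurable (q @^-1` [set v])) ->
  bounded_meas (h \o q) /\
  (\int[mu]_z h (q z) = \sum_(v < N) fine (mu (q @^-1` [set v])) * h v)%R.
Proof.
move=> mq.
have b1 v : bounded_meas (fun z => h v * \1_(q @^-1` [set v]) z).
  apply: bounded_measZ; split; first exact: measurable_indic.
  by exists 1 => z; rewrite indicE; case: (_ \in _); rewrite ?normr1 ?normr0.
have hq z : h (q z) = \sum_(v < N) h v * \1_(q @^-1` [set v]) z.
  rewrite (bigD1 (q z))//= indicE mem_set//= mulr1 big1 ?addr0// => v vq.
  by rewrite indicE memNset ?mulr0//= => qz; rewrite qz eqxx in vq.
split.
  have := bounded_meas_sum (index_enum 'I_N) b1.
  by congr bounded_meas; apply/funext => z /=; rewrite hq.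
under eq_Rintegral do rewrite hq.
rewrite Rintegral_sum//; apply: eq_bigr => v _.
rewrite RintegralZl//.
  by rewrite /Rintegral integral_indic// setIT mulrC.
apply: bounded_meas_integrable; split; first exact: measurable_indic.
by exists 1 => z; rewrite indicE; case: (_ \in _); rewrite ?normr1 ?normr0.
Qed.

Lemma cint_quantized {d} {T : measurableType d} {R : realType}
    (mu : {finite_measure set T -> \bar R}) (N : nat) (q : T -> 'I_N)
    (h : 'I_N -> R[i]) : (forall v, measurable (q @^-1` [set v])) ->
  cbounded_meas (h \o q) /\
  cint mu (h \o q) = \sum_(v < N) (fine (mu (q @^-1` [set v])))%:C * h v.
Proof.
move=> mq.
have [bR hR] := Rintegral_quantized mu (fun v => complex.Re (h v)) mq.
have [bI hI] := Rintegral_quantized mu (fun v => complex.Im (h v)) mq.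
split; first by split.
apply/eqP; rewrite eq_complex Re_sum Im_sum /cint /= hR hI.
by apply/andP; split; apply/eqP; apply: eq_bigr => v _;
  rewrite ?Re_mul ?Im_mul /= mul0r ?subr0 ?addr0.
Qed.

Lemma sum_outside_le {R : realType} (I : eqType) (s b : seq I) (F : I -> R) :
  (forall i, 0 <= F i) -> uniq s -> uniq b ->
  \sum_(i <- s) F i <=
    \sum_(i <- b) F i + \sum_(i <- s | i \notin b) F i.
Proof.
move=> F0 us ub; rewrite (bigID (mem b)) /= lerD2r -big_filter.
rewrite (perm_big [seq i <- b | i \in s]) /=; last first.
  apply: uniq_perm; rewrite ?filter_uniq// => i.
  by rewrite !mem_filter andbC.
rewrite big_filter [leRHS](bigID (mem s)) /= lerDl.
by apply: sumr_ge0 => i _; exact: F0.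
Qed.

(* The mixture of the rank-one operators |psi_z><psi_z| is approximated by
   replacing z with a representative of its cell in a finite partition of T.
   The cells are chosen such that the components of psi_z in a finite box and
   the weight of psi_z outside of this box are almost constant in each cell. *)
Lemma mixture_trace_norm_approx {d} {T : measurableType d} {R : realType}
    (tau : probability T R) (I : choiceType) (psi : T -> I -> R[i])
    (box : nat -> seq I) (eps : R) :
  (forall i, cbounded_meas (psi ^~ i)) ->
  (forall z s, uniq s -> \sum_(i <- s) sqnormc (psi z i) <= 1) ->
  (forall M, uniq (box M)) ->
  (forall z, \sum_(i <- box M) sqnormc (psi z i) @[M --> \oo] --> (1 : R)) ->
  0 < eps ->
  exists (N : nat) (p : 'I_N -> R) (w : 'I_N -> T),
    [/\ forall l, 0 <= p l, \sum_(l < N) p l = 1 &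
     (trace_norm (fun i j => cint tau (fun z => psi z i * (psi z j)^*%C) -
        \sum_(l < N) (p l)%:C * (psi (w l) i * (psi (w l) j)^*%C))%R
        < eps%:E)%E].
Proof.
move=> bpsi psi1 ubox cbox eps0.
pose tail M z := 1 - \sum_(i <- box M) sqnormc (psi z i).
have btail M : bounded_meas (tail M).
  apply: bounded_measB; first exact: bounded_meas_cst.
  by apply: bounded_meas_sum => i; exact: cbounded_meas_sqnormc.
have tail0 M z : 0 <= tail M z by rewrite subr_ge0 psi1.
have tail1 M z : tail M z <= 1.
  by rewrite gerBl sumr_ge0// => i _; exact: sqnormc_ge0.
(* Dominated convergence: the tails are at most 1 and tend to 0 pointwise. The bound is chosen so
   that 4 / eta times it is eps / 4 for the later eta = eps / 4. *)
have [M tailM] : exists M, \int[tau]_z tail M z < eps ^+ 2 / 64.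
  have mt N : measurable_fun setT (fun z => (tail N z)%:E).
    by apply/measurable_EFinP; have [] := btail N.
  have cvgt : {ae tau, forall z, setT z ->
      (fun N => (tail N z)%:E) @ \oo --> (cst 0%E : T -> \bar R) z}.
    apply: aeW => z _; apply: cvg_EFin; first exact: nearW.
    have -> : (0 : R) = 1 - 1 by rewrite subrr.
    by apply: cvgB => //; exact: cvg_cst.
  have bt : {ae tau, forall z N, setT z ->
      (`|(tail N z)%:E| <= (cst 1%E : T -> \bar R) z)%E}.
    by apply: aeW => z N _; rewrite /= lee_fin ger0_norm.
  have i1 : tau.-integrable setT (cst 1%E : T -> \bar R).
    exact: (bounded_meas_integrable tau (bounded_meas_cst 1)).
  have [_ _] := dominated_convergence measurableT mt (measurable_cst _) cvgt i1 bt.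
  rewrite /= integral_cst// mul0e => /fine_cvgP[_ /cvgrPdist_lt].
  move=> /(_ (eps ^+ 2 / 64)) [|N _ /(_ N (leqnn N))].
    by rewrite divr_gt0 ?exprn_gt0.
  rewrite /= sub0r normrN => tN; exists N.
  exact: le_lt_trans (ler_norm _) tN.
pose b : R := (size (box M))%:R.
have b0 : 0 <= b by rewrite ler0n.
(* The minimum with 1 ensures x^2 <= [del] when |x| <= [del]. The factor 2b + 2 counts the real and
   imaginary parts of the b components in the box, and twice the change of the tail within a
   cell. *)
pose del := Num.min 1 (eps ^+ 2 / (16 * (2 * b + 2))).
have bb0 : 0 < 2 * b + 2 by lra.
have del0 : 0 < del.
  by rewrite lt_min ltr01 divr_gt0 ?exprn_gt0 ?mulr_gt0.
have del1 : del <= 1 by rewrite ge_min lexx.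
have delE : (2 * b + 2) * del <= eps ^+ 2 / 16.
  have : del <= eps ^+ 2 / (16 * (2 * b + 2)) by rewrite ge_min lexx orbT.
  rewrite -(ler_pM2l bb0) => /le_trans; apply.
  have -> : (2 * b + 2) * (eps ^+ 2 / (16 * (2 * b + 2))) = eps ^+ 2 / 16.
    by field; rewrite gt_eqF.
  by [].
pose Q (o : option (bool * I)) (z : T) : R :=
  match o with
  | None => tail M z
  | Some (true, i) => complex.Re (psi z i)
  | Some (false, i) => complex.Im (psi z i)
  end.
have bQ o : bounded_meas (Q o).
  by case: o => [[[] i]|] /=; [case: (bpsi i)|case: (bpsi i)|exact: btail].
pose codes : seq (option (bool * I)) := None ::
  [seq Some (true, i) | i <- box M] ++ [seq Some (false, i) | i <- box M].
have [N [q [mq qQ]]] := bounded_meas_quantize_seq codes bQ del0.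
(* T is nonempty because it has probability 1; [t0] represents the empty cells, whose weight is
   0. *)
have [t0 _] : exists t0 : T, True.
  apply: contrapT => noT.
  have T0 : [set: T] = set0 by apply/seteqP; split=> z // _; by case: noT; exists z.
  have := @probability_setT _ _ _ tau; rewrite T0 measure0 => /esym/eqP.
  by rewrite onee_eq0.
pose w (v : 'I_N) : T :=
  match pselect (exists z, q z = v) with
  | left ex => sval (cid ex)
  | right _ => t0
  end.
have qw z : q (w (q z)) = q z.
  rewrite /w; case: pselect => [ex|]; first exact: (svalP (cid ex)).
  by case; exists z.
have close z s : uniq s ->
    \sum_(i <- s) sqnormc (psi z i - psi (w (q z)) i) <=
    eps ^+ 2 / 16 + 4 * tail M z.
  move=> us; set y := w (q z).
  have Qzy o : o \in codes -> `|Q o z - Q o y| <= del.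
    by apply: qQ; rewrite qw.
  have sq_le (x : R) : `|x| <= del -> x ^+ 2 <= del.
    rewrite -[x ^+ 2]real_normK ?num_real// => xd.
    by rewrite expr2 (le_trans (ler_pM _ _ xd (le_trans xd del1)))// mulr1.
  have tail_y : tail M y <= tail M z + del.
    have /Qzy /= : None \in codes by rewrite inE.
    by rewrite ler_norml => /andP[]; lra.
  have in_box : \sum_(i <- box M) sqnormc (psi z i - psi y i) <= 2 * b * del.
    have -> : 2 * b * del = \sum_(i <- box M) (2 * del).
      by rewrite big_const_seq count_predT iter_addr_0 -[RHS]mulr_natl -/b; ring.
    rewrite !(big_seq _ _ _ (fun i => _)) /=; apply: ler_sum => i iM.
    have /Qzy /= /sq_le re : Some (true, i) \in codes.
      by rewrite inE mem_cat (map_f (fun i => Some (true, i)) iM) orbT.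
    have /Qzy /= /sq_le im : Some (false, i) \in codes.
      by rewrite inE mem_cat (map_f (fun i => Some (false, i)) iM) !orbT.
    rewrite /sqnormc; case: (psi z i) (psi y i) re im => [a a'] [c c'] /=.
    lra.
  have out_box x : \sum_(i <- s | i \notin box M) sqnormc (psi x i) <= tail M x.
    rewrite lerBrDr -big_filter -big_cat /=; apply: psi1.
    rewrite cat_uniq filter_uniq// ubox andbT; apply/hasPn => i iM /=.
    by rewrite mem_filter iM.
  apply: le_trans (sum_outside_le _ us (ubox M)) _ => [i|].
    exact: sqnormc_ge0.
  have : \sum_(i <- s | i \notin box M) sqnormc (psi z i - psi y i) <=
      2 * tail M z + 2 * tail M y.
    apply: (@le_trans _ _ (\sum_(i <- s | i \notin box M)
      (2 * sqnormc (psi z i) + 2 * sqnormc (psi y i)))).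
      by apply: ler_sum => i _; exact: sqnormcB_le.
    rewrite big_split /= -!mulr_sumr lerD// ler_pM2l//; exact: out_box.
  move: delE; rewrite mulrDl; lra.
pose p l := fine (tau (q @^-1` [set l])).
exists N, p, w; split.
- by move=> l; rewrite fine_ge0.
- have [_] := Rintegral_quantized tau (fun=> 1) mq.
  rewrite Rintegral_cst// [X in _ * fine X](probability_setT tau) /= mul1r => ->.
  by apply: eq_bigr => v _; rewrite mulr1.
pose Y i j z := psi z i * (psi z j)^*%C -
                psi (w (q z)) i * (psi (w (q z)) j)^*%C.
have bY1 i j : cbounded_meas (fun z => psi z i * (psi z j)^*%C).
  by apply: cbounded_measM => //; exact: cbounded_measJ.
pose h i j v := psi (w v) i * (psi (w v) j)^*%C.
have bh i j := (cint_quantized tau (h i j) mq).1.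
have bY i j : cbounded_meas (Y i j) by exact: cbounded_measB (bY1 i j) (bh i j).
have YE i j : cint tau (fun z => psi z i * (psi z j)^*%C) -
    \sum_(l < N) (p l)%:C * (psi (w l) i * (psi (w l) j)^*%C) =
    cint tau (Y i j).
  rewrite -(cintB _ (bY1 i j) (bh i j)); congr (_ - _).
  by rewrite (cint_quantized tau (h i j) mq).2.
(* Three contributions of eps / 4 each: the variation within cells divided by eta, eta itself, and
   the tail. A supremum of bounded pairings only yields a weak inequality, whence the margin. *)
apply: (@le_lt_trans _ _ (3 / 4 * eps)%:E); last by rewrite lte_fin; lra.
apply: ge_ereal_sup => _ [s [r [e [f [us eO fO ->]]]]]; rewrite lee_fin.
under eq_bigr do under eq_bigr do under eq_bigr do rewrite YE.
pose vk k := \sum_(i <- s) \sum_(j <- s)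
  (e k i)^*%C * cint tau (Y i j) * f k j.
have /choice [u uP] := fun k => phase_exists (vk k).
rewrite -/vk (eq_bigr (fun k => complex.Re (u k * vk k))); last first.
  by move=> k _; have [] := uP k.
rewrite -Re_sum.
(* The sum of pairings, with its phases, is the integral of [G], and [pairing_rank_one_le] bounds
   the real part of [G z] for each z separately. *)
pose G z := \sum_(k < r) u k * \sum_(i <- s) \sum_(j <- s)
  (e k i)^*%C * Y i j z * f k j.
have bG3 k i j : cbounded_meas (fun z => (e k i)^*%C * Y i j z * f k j).
  by apply: cbounded_measM; [apply: cbounded_measM|]; rewrite //;
    exact: cbounded_meas_cst.
have bG2 k i : cbounded_meas (fun z => \sum_(j <- s)
    (e k i)^*%C * Y i j z * f k j) by exact: cbounded_meas_sum.
have bG1 k : cbounded_meas (fun z => \sum_(i <- s) \sum_(j <- s)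
    (e k i)^*%C * Y i j z * f k j) by exact: cbounded_meas_sum.
have bG0 k : cbounded_meas (fun z => u k * \sum_(i <- s) \sum_(j <- s)
    (e k i)^*%C * Y i j z * f k j).
  by apply: cbounded_measM => //; exact: cbounded_meas_cst.
have -> : \sum_(k < r) u k * vk k = cint tau G.
  rewrite cint_sum//; apply: eq_bigr => k _; rewrite cintZ//; congr (_ * _).
  rewrite cint_sum//; apply: eq_bigr => i _.
  rewrite cint_sum//; apply: eq_bigr => j _.
  rewrite mulrAC -cintZ//; apply: eq_cint => z; ring.
pose eta := eps / 4.
have eta0 : 0 < eta by rewrite divr_gt0.
pose K z := (eps ^+ 2 / 16 / eta + eta) + 4 / eta * tail M z.
have bK : bounded_meas K.
  by apply: bounded_measD; [exact: bounded_meas_cst|exact: bounded_measZ].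
apply: (@le_trans _ _ (\int[tau]_z K z)).
  apply: le_Rintegral => //.
  - apply: bounded_meas_integrable.
    by have [] := cbounded_meas_sum (index_enum 'I_r) bG0.
  - exact: bounded_meas_integrable.
  move=> z _; apply: le_trans (pairing_rank_one_le eta0 eO fO _ _ _) _.
  - by move=> k; have [] := uP k.
  - exact: psi1.
  - exact: psi1.
  rewrite /K addrAC lerD2r.
  have -> : eps ^+ 2 / 16 / eta + 4 / eta * tail M z =
    (eps ^+ 2 / 16 + 4 * tail M z) / eta by ring.
  by rewrite ler_pM2r ?invr_gt0// close.
rewrite RintegralD//; last 2 first.
- exact/bounded_meas_integrable/bounded_meas_cst.
- exact/bounded_meas_integrable/bounded_measZ.
rewrite Rintegral_cst// [X in _ * fine X](probability_setT tau) /= mulr1.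
rewrite RintegralZl//; last exact: bounded_meas_integrable.
have : 4 / eta * \int[tau]_z tail M z <= 4 / eta * (eps ^+ 2 / 64).
  by rewrite ler_pM2l ?divr_gt0// ltW.
have -> : 4 / eta * (eps ^+ 2 / 64) = eps / 4.
  by rewrite /eta; field; rewrite gt_eqF.
have -> : eps ^+ 2 / 16 / eta = eps / 4.
  by rewrite /eta; field; rewrite gt_eqF.
rewrite /eta; lra.
Qed.

(** * Coherent states *)

(** Probability of j quanta in a coherent state with |z|^2 = x. *)
Definition poisson_weight {R : realType} (x : R) (j : nat) : R :=
  expR (- x) * exp_coeff x j.

Lemma poisson_weight_ge0 {R : realType} (x : R) (j : nat) :
  0 <= x -> 0 <= poisson_weight x j.
Proof. by move=> x0; rewrite mulr_ge0 ?expR_ge0 ?exp_coeff_ge0. Qed.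

Lemma cvg_sum_poisson_weight {R : realType} (x : R) :
  \sum_(j < M) poisson_weight x j @[M --> \oo] --> (1 : R).
Proof.
have -> : (fun M => \sum_(j < M) poisson_weight x j) =
    (fun M => expR (- x) * series (exp_coeff x) M).
  by apply/funext => M; rewrite -mulr_sumr /series /= big_mkord.
have -> : (1 : R) = expR (- x) * expR x by rewrite expRN mulVf ?expR_eq0.
by apply: cvgM; [exact: cvg_cst|exact: is_cvg_series_exp_coeff].
Qed.

Lemma sum_poisson_weight_le1 {R : realType} (x : R) (M : nat) :
  0 <= x -> \sum_(j < M) poisson_weight x j <= 1.
Proof.
move=> x0.
have nd : nondecreasing_seq (fun M => \sum_(j < M) poisson_weight x j).
  apply/nondecreasing_seqP => N; rewrite big_ord_recr /= lerDl.
  exact: poisson_weight_ge0.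
have cv := @cvg_sum_poisson_weight _ x.
by have := nondecreasing_cvgn_le nd (cvgP _ cv) M; rewrite (cvg_lim _ cv).
Qed.

(** Index shift: j x^j / j! = x x^(j-1) / (j-1)!. *)
Lemma sum_poisson_weight_mean_le {R : realType} (x : R) (M : nat) :
  0 <= x -> \sum_(j < M) j%:R * poisson_weight x j <= x.
Proof.
move=> x0; case: M => [|M]; first by rewrite big_ord0.
rewrite big_ord_recl mul0r add0r.
have -> : \sum_(i < M) (lift ord0 i)%:R * poisson_weight x (lift ord0 i) =
    x * \sum_(i < M) poisson_weight x i.
  rewrite mulr_sumr; apply: eq_bigr => i _.
  rewrite /poisson_weight /exp_coeff /= /bump /= add1n factS natrM exprS.
  by field; rewrite pnatr_eq0 -lt0n fact_gt0 addrC natr1 pnatr_eq0.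
by rewrite ler_piMr// sum_poisson_weight_le1.
Qed.

Lemma sqmod_ge0 {R : realType} (z : Cplx R) : 0 <= sqmod z.
Proof. by rewrite addr_ge0 ?sqr_ge0. Qed.

Lemma measurable_sqmod {R : realType} :
  measurable_fun [set: Cplx R] (fun z : Cplx R => sqmod z).
Proof.
by apply: measurable_funD; apply: measurable_funX;
  [exact: measurable_fst|exact: measurable_snd].
Qed.

Lemma sqnormc_coherent1 {R : realType} (z : Cplx R) (j : nat) :
  sqnormc (coherent1 z j) = poisson_weight (sqmod z) j.
Proof.
have sqC (a : R) : sqnormc a%:C = a ^+ 2 by rewrite /sqnormc /= expr0n addr0.
have sqX (a : R[i]) : sqnormc (a ^+ j) = sqnormc a ^+ j.
  elim: j => [|k IH]; first by rewrite !expr0 sqC expr1n.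
  by rewrite !exprS sqnormcM IH.
rewrite /coherent1 -fmorphV !sqnormcM !sqC sqX exprVn sqr_sqrtr//.
rewrite /poisson_weight /exp_coeff /= -mulrA; congr (_ * (_ / _)).
by rewrite expr2 -expRD -splitr.
Qed.

Lemma sqnormc_coherent {R : realType} (n : nat) (z : Cn R n) (i : fock n) :
  sqnormc (coherent z i) = \prod_(k < n) poisson_weight (sqmod (tnth z k)) (i k).
Proof.
by rewrite sqnormc_prod; apply: eq_bigr => k _; exact: sqnormc_coherent1.
Qed.

(** Boxes exhaust the Fock indices, and sums of products over a box factor into one sum per mode. *)
Definition fock_box (n M : nat) : seq (fock n) :=
  [seq ([ffun k => (h k : nat)] : fock n) |
    h : {ffun 'I_n -> 'I_M} <- enum {: {ffun 'I_n -> 'I_M}}].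

Lemma fock_box_uniq n M : uniq (fock_box n M).
Proof.
rewrite map_inj_uniq ?enum_uniq// => h1 h2 /ffunP h12; apply/ffunP => k.
by apply/val_inj; have := h12 k; rewrite !ffunE.
Qed.

Lemma mem_fock_box n M (i : fock n) : (forall k, i k < M)%N -> i \in fock_box n M.
Proof.
move=> iM; apply/mapP; exists [ffun k => Ordinal (iM k)]; rewrite ?mem_enum//.
by apply/ffunP => k; rewrite !ffunE.
Qed.

Lemma sub_fock_box n (s : seq (fock n)) :
  exists M, {subset s <= fock_box n M}.
Proof.
exists (\max_(i <- s) \max_(k < n) i k).+1 => i si; apply: mem_fock_box => k.
rewrite ltnS; apply: (@leq_trans (\max_(k < n) i k)); first exact: leq_bigmax.
exact: (leq_bigmax_seq (F := fun i : fock n => \max_(k < n) i k)) si isT.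
Qed.

Lemma sum_fock_box {R : comPzRingType} n M (F : 'I_n -> nat -> R) :
  \sum_(i <- fock_box n M) \prod_(k < n) F k (i k) =
  \prod_(k < n) \sum_(j < M) F k j.
Proof.
rewrite big_map big_enum /= bigA_distr_bigA /=.
by apply: eq_bigr => h _; apply: eq_bigr => k _; rewrite ffunE.
Qed.

Lemma ler_sum_fock_box {R : realType} n (s : seq (fock n)) (F : fock n -> R)
    (B : R) : (forall i, 0 <= F i) -> uniq s ->
  (forall M, \sum_(i <- fock_box n M) F i <= B) -> \sum_(i <- s) F i <= B.
Proof.
move=> F0 us FB; have [M sM] := sub_fock_box s.
apply: le_trans (sum_outside_le F0 us (fock_box_uniq n M)) _.
rewrite [X in _ + X]big_seq_cond [X in _ + X]big1 ?addr0// => i /andP[/sM ->].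
by [].
Qed.

Lemma sum_sqnormc_coherent_le1 {R : realType} (n : nat) (z : Cn R n)
    (s : seq (fock n)) : uniq s -> \sum_(i <- s) sqnormc (coherent z i) <= 1.
Proof.
move=> us; apply: ler_sum_fock_box => // [i|M]; first exact: sqnormc_ge0.
under eq_bigr do rewrite sqnormc_coherent.
rewrite (sum_fock_box M (fun k => poisson_weight (sqmod (tnth z k)))).
apply: prodr_ile1 => k _; rewrite sum_poisson_weight_le1 ?sqmod_ge0// andbT.
by apply: sumr_ge0 => j _; rewrite poisson_weight_ge0 ?sqmod_ge0.
Qed.

Lemma cvg_sum_sqnormc_coherent {R : realType} (n : nat) (z : Cn R n) :
  \sum_(i <- fock_box n M) sqnormc (coherent z i) @[M --> \oo] --> (1 : R).
Proof.
have -> : (fun M => \sum_(i <- fock_box n M) sqnormc (coherent z i)) =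
    (fun M => \prod_(k < n) \sum_(j < M) poisson_weight (sqmod (tnth z k)) j).
  apply/funext => M; under eq_bigr do rewrite sqnormc_coherent.
  exact: (sum_fock_box M (fun k => poisson_weight (sqmod (tnth z k)))).
elim: (index_enum _) => [|k s IHs].
  by under eq_fun do rewrite big_nil; exact: cvg_cst.
under eq_fun do rewrite big_cons.
have := cvgM (@cvg_sum_poisson_weight _ (sqmod (tnth z k))) IHs; rewrite mulr1.
by apply.
Qed.

(** On a box the sum factors over the modes once the number i_k is absorbed into the k-th factor:
    that factor is a truncated Poisson mean, and the others are at most 1. *)
Lemma coherent_energy_le {R : realType} (n : nat) (z : Cn R n) (k : 'I_n)
    (s : seq (fock n)) : uniq s ->
  \sum_(i <- s) (i k)%:R * sqnormc (coherent z i) <= sqmod (tnth z k).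
Proof.
move=> us; apply: ler_sum_fock_box => // [i|M].
  by rewrite mulr_ge0// sqnormc_ge0.
pose F (l : 'I_n) (j : nat) : R := (if l == k then j%:R else 1) *
  poisson_weight (sqmod (tnth z l)) j.
have -> : \sum_(i <- fock_box n M) (i k)%:R * sqnormc (coherent z i) =
    \sum_(i <- fock_box n M) \prod_(l < n) F l (i l).
  apply: eq_bigr => i _; rewrite sqnormc_coherent /F [RHS]big_split /=; congr (_ * _).
  by rewrite -big_mkcond big_pred1_eq.
rewrite sum_fock_box (bigD1 k)//= /F eqxx.
have p0 l j : 0 <= poisson_weight (sqmod (tnth z l)) j.
  by rewrite poisson_weight_ge0 ?sqmod_ge0.
apply: le_trans (sum_poisson_weight_mean_le M (sqmod_ge0 (tnth z k))).
rewrite ler_piMr//; first by apply: sumr_ge0 => j _; rewrite mulr_ge0.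
apply: prodr_ile1 => l /negbTE ->; under eq_bigr do rewrite mul1r.
rewrite sum_poisson_weight_le1 ?sqmod_ge0// andbT.
by apply: sumr_ge0 => j _.
Qed.

Lemma cbounded_meas_coherent1 {R : realType} (j : nat) :
  cbounded_meas (fun z : Cplx R => coherent1 z j).
Proof.
have m1 : measurable_fun setT (fun z : Cplx R => z.1) by exact: measurable_fst.
have m2 : measurable_fun setT (fun z : Cplx R => z.2) by exact: measurable_snd.
have mX : measurable_fun setT
      (fun z : Cplx R => complex.Re ((z.1 +i* z.2) ^+ j)) /\
    measurable_fun setT (fun z : Cplx R => complex.Im ((z.1 +i* z.2) ^+ j)).
  elim: j => [|j [IHr IHi]].
    by split; under eq_fun do rewrite expr0; exact: measurable_cst.
  split; under eq_fun do rewrite exprS ?Re_mul ?Im_mul /=.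
    by apply: measurable_funB; exact: measurable_funM.
  by apply: measurable_funD; exact: measurable_funM.
have mexp : measurable_fun setT (fun z : Cplx R => expR (- (sqmod z) / 2)).
  apply: measurableT_comp => //; apply: measurable_funM => //.
  by apply: measurable_funN; exact: measurable_sqmod.
have cE (z : Cplx R) : coherent1 z j =
    (expR (- (sqmod z) / 2) / Num.sqrt (j`!%:R : R))%:C * (z.1 +i* z.2) ^+ j.
  by rewrite /coherent1 rmorphM /= fmorphV mulrAC.
have le1 (z : Cplx R) : sqnormc (coherent1 z j) <= 1.
  rewrite sqnormc_coherent1.
  apply: le_trans (sum_poisson_weight_le1 j.+1 (sqmod_ge0 z)).
  rewrite big_ord_recr /= lerDr; apply: sumr_ge0 => i _.
  by rewrite poisson_weight_ge0 ?sqmod_ge0.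
split; (split; last by exists 1 => z; by [exact: norm_Re_le1|exact: norm_Im_le1]).
  under eq_fun do rewrite cE Re_mul /= mul0r subr0.
  by apply: measurable_funM; [exact: measurable_funM|case: mX].
under eq_fun do rewrite cE Im_mul /= mul0r addr0.
by apply: measurable_funM; [exact: measurable_funM|case: mX].
Qed.

Lemma cbounded_meas_coherent {R : realType} (n : nat) (i : fock n) :
  cbounded_meas (fun z : Cn R n => coherent z i).
Proof.
rewrite /coherent; elim: (index_enum _) => [|k s IHs].
  by under eq_fun do rewrite big_nil; exact: cbounded_meas_cst.
under eq_fun do rewrite big_cons.
apply: cbounded_measM => //.
have [[mr [A rA]] [mi [B iB]]] := @cbounded_meas_coherent1 R (i k).
have mt := @measurable_tnth _ (Cplx R) n k.
split; split.
- exact: (measurableT_comp mr mt).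
- by exists A => z; exact: rA.
- exact: (measurableT_comp mi mt).
- by exists B => z; exact: iB.
Qed.

Lemma cbounded_meas_coherent_state {R : realType} (n : nat) (i j : fock n) :
  cbounded_meas (fun z : Cn R n => coherent_state z i j).
Proof.
apply: cbounded_measM; first exact: cbounded_meas_coherent.
exact/cbounded_measJ/cbounded_meas_coherent.
Qed.

(** Heredity asks for this twice: of the dominating state and of the dominated one. *)
Lemma classical_rho_of {R : realType} (n : nat) (mu : probability (Cn R n) R) :
  classical (rho_of mu).
Proof.
move=> eps eps0.
have [N [p [w [p0 p1 pw]]]] := mixture_trace_norm_approx mu
  (@cbounded_meas_coherent R n) (@sum_sqnormc_coherent_le1 R n)
  (fock_box_uniq n) (@cvg_sum_sqnormc_coherent R n) eps0.
exists (fun i j => \sum_(l < N) (p l)%:C * coherent_state (w l) i j) => //.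
by exists N, p, w.
Qed.

(** * Entropy bound *)

Lemma cvg_sumr {R : realType} (I : Type) (s : seq I) (F : I -> nat -> R)
    (l : I -> R) : (forall i, F i M @[M --> \oo] --> l i) ->
  \sum_(i <- s) F i M @[M --> \oo] --> \sum_(i <- s) l i.
Proof.
move=> Fl; elim: s => [|i s IHs].
  by under eq_fun do rewrite big_nil; rewrite big_nil; exact: cvg_cst.
by under eq_fun do rewrite big_cons; rewrite big_cons; exact: cvgD.
Qed.

Lemma ge0_rsum {R : realType} (I : choiceType) (D : set I) (F : I -> R) :
  (forall i, D i -> 0 <= F i) -> rsum D F = fine (\esum_(i in D) (F i)%:E).
Proof.
move=> F0; rewrite /rsum [X in _ - fine X]esum1 ?subr0 => [|i Di]; last first.
  by rewrite (elimT max_idPr)// oppr_le0 F0.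
by congr fine; apply: eq_esum => i Di; rewrite (elimT max_idPl)// F0.
Qed.

Lemma cvg_ge0_esum {R : realType} (F : nat -> R) : (forall i, 0 <= F i) ->
  (\esum_(i in [set: nat]) (F i)%:E < +oo)%E ->
  \sum_(i < M) F i @[M --> \oo] --> fine (\esum_(i in [set: nat]) (F i)%:E).
Proof.
move=> F0; have F0' i : (0 <= (F i)%:E)%E by rewrite lee_fin.
rewrite -nneseries_esumT// => Foo.
have /fine_cvgP[_] : (\sum_(0 <= i < M) (F i)%:E)%E @[M --> \oo] -->
    (fine (\sum_(0 <= i <oo) (F i)%:E)%E)%:E.
  rewrite fineK; first exact: is_cvg_nneseries.
  by rewrite ge0_fin_numE// nneseries_ge0.
by apply: cvg_trans; apply: near_eq_cvg; apply: nearW => M /=;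
  rewrite sumEFin big_mkord.
Qed.

Lemma cvg_rsum {R : realType} (F : nat -> R) :
  (\esum_(i in [set: nat]) `|F i|%:E < +oo)%E ->
  \sum_(i < M) F i @[M --> \oo] --> rsum [set: nat] F.
Proof.
move=> Foo.
have le_oo (G : nat -> R) : (forall i, G i <= `|F i|) ->
    (\esum_(i in [set: nat]) (G i)%:E < +oo)%E.
  by move=> GF; apply: le_lt_trans Foo; apply: le_esum => i _; rewrite lee_fin.
have c1 : \sum_(i < M) Num.max (F i) 0 @[M --> \oo] -->
    fine (\esum_(i in [set: nat]) (Num.max (F i) 0)%:E).
  apply: cvg_ge0_esum => [i|]; first by rewrite le_max lexx orbT.
  by apply: le_oo => i; rewrite ge_max ler_norm normr_ge0.
have c2 : \sum_(i < M) Num.max (- F i) 0 @[M --> \oo] -->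
    fine (\esum_(i in [set: nat]) (Num.max (- F i) 0)%:E).
  apply: cvg_ge0_esum => [i|]; first by rewrite le_max lexx orbT.
  by apply: le_oo => i; rewrite ge_max -normrN ler_norm normr_ge0.
have -> : (fun M => \sum_(i < M) F i) = (fun M =>
    \sum_(i < M) Num.max (F i) 0 - \sum_(i < M) Num.max (- F i) 0).
  apply/funext => M; rewrite -sumrB; apply: eq_bigr => i _.
  case: (leP 0 (F i)) => Fi.
    by rewrite (elimT max_idPr) ?oppr_le0// subr0.
  by rewrite (elimT max_idPl) ?oppr_ge0 ?ltW// sub0r opprK.
exact: cvgB c1 c2.
Qed.

(** Orthonormality holds for the infinite sums only, so Bessel's inequality is applied to truncated
    vectors, whose Gram matrices [G M] tend to the identity. With S the sum to be bounded, the limit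
    of [gram_bessel] for the j-th basis vector reads 2 S <= 1 + S. *)
Lemma bessel_basis_vector {R : realType} (e : nat -> nat -> R[i]) (j K : nat) :
  (forall k, (\esum_(i in [set: nat]) (sqnormc (e k i))%:E < +oo)%E) ->
  (forall k l, csum [set: nat] (fun i => (e k i)^*%C * e l i) = (k == l)%:R) ->
  \sum_(k < K) sqnormc (e k j) <= 1.
Proof.
move=> e_fin eO.
pose G M k l := \sum_(i < M) (e k i)^*%C * e l i.
(* Domination by a sum of squares makes the scalar products absolutely convergent, hence limits of
   their partial sums. *)
have abs_le (x y : R[i]) :
    `|complex.Re (x^*%C * y)| <= sqnormc x + sqnormc y /\
    `|complex.Im (x^*%C * y)| <= sqnormc x + sqnormc y.
  case: x y => [a b] [c d]; rewrite /sqnormc /= !ler_norml.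
  have := sqr_ge0 (a + c); have := sqr_ge0 (a - c).
  have := sqr_ge0 (b + d); have := sqr_ge0 (b - d).
  have := sqr_ge0 (a + d); have := sqr_ge0 (a - d).
  have := sqr_ge0 (b + c); have := sqr_ge0 (b - c).
  by split; apply/andP; split; nra.
have sum_fin k l (H : nat -> R) :
    (forall i, `|H i| <= sqnormc (e k i) + sqnormc (e l i)) ->
    (\esum_(i in [set: nat]) `|H i|%:E < +oo)%E.
  move=> He; apply: (@le_lt_trans _ _ (\esum_(i in [set: nat])
      ((sqnormc (e k i))%:E + (sqnormc (e l i))%:E))%E).
    by apply: le_esum => i _; rewrite -EFinD lee_fin.
  by rewrite esumD ?lte_add_pinfty// => i _; rewrite lee_fin sqnormc_ge0.
have cRe k l : complex.Re (G M k l) @[M --> \oo] --> ((k == l)%:R : R).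
  have := @cvg_rsum _ (fun i => complex.Re ((e k i)^*%C * e l i))
    (sum_fin k l _ (fun i => (abs_le (e k i) (e l i)).1)).
  have -> : rsum [set: nat] (fun i => complex.Re ((e k i)^*%C * e l i)) =
      (k == l)%:R.
    by have /(congr1 (@complex.Re R)) /= := eO k l => ->; case: (k == l).
  by under eq_fun do rewrite -Re_sum.
have cIm k l : complex.Im (G M k l) @[M --> \oo] --> (0 : R).
  have := @cvg_rsum _ (fun i => complex.Im ((e k i)^*%C * e l i))
    (sum_fin k l _ (fun i => (abs_le (e k i) (e l i)).2)).
  have -> : rsum [set: nat] (fun i => complex.Im ((e k i)^*%C * e l i)) = 0.
    by have /(congr1 (@complex.Im R)) /= := eO k l => ->; case: (k == l).
  by under eq_fun do rewrite -Im_sum.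
pose c k l : R[i] := e k j * (e l j)^*%C.
pose S := \sum_(k < K) sqnormc (e k j).
pose T M := \sum_(k < K) \sum_(l < K) complex.Re (c k l * G M k l).
have cT : T M @[M --> \oo] --> S.
  have -> : S = \sum_(k < K) \sum_(l < K)
      (complex.Re (c k l) * (val k == val l)%:R - complex.Im (c k l) * 0).
    apply: eq_bigr => k _; rewrite (bigD1 k)//= big1 ?addr0 => [|l lk].
      by rewrite eqxx mulr1 mulr0 subr0 /c mulrC sqnormcE.
    by rewrite -val_eqE eq_sym /= in lk; rewrite (negbTE lk) !mulr0 subr0.
  apply: cvg_sumr => k.
  apply: cvg_sumr => l.
  under eq_fun do rewrite Re_mul.
  by apply: cvgB; apply: cvgM => //; exact: cvg_cst.
suff : 2 * S <= 1 + S by rewrite -/S; lra.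
have cR : 1 + T M @[M --> \oo] --> 1 + S.
  by apply: cvgD => //; exact: cvg_cst.
apply: (cvgr_to_ge cR).
(* From here on the index j survives the truncation: the basis vector still has norm 1 and its
   products with the e_k are exact. *)
exists j.+1 => // M /= jM.
have bE (k : 'I_K) : (e k j)^*%C = \sum_(i <- enum 'I_M)
    (e k i)^*%C * ((i : nat) == j)%:R.
  rewrite big_enum (bigD1 (Ordinal jM)) //= eqxx mulr1 big1 ?addr0// => i.
  by rewrite -val_eqE /= => /negbTE ->; rewrite mulr0.
have := @gram_bessel _ _ (enum 'I_M) K (fun k i => e k i)
  (fun i : 'I_M => ((i : nat) == j)%:R) (fun k => (e k j)^*%C) bE.
have -> : \sum_(k < K) sqnormc (e k j)^*%C = S.
  by apply: eq_bigr => k _; rewrite sqnormcJ.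
have -> : \sum_(i <- enum 'I_M) sqnormc (((i : nat) == j)%:R : R[i]) = 1.
  rewrite big_enum (bigD1 (Ordinal jM)) //= eqxx big1 ?addr0 => [|i].
    by rewrite /sqnormc /= expr1n expr0n addr0.
  by rewrite -val_eqE /= => /negbTE ->; rewrite /sqnormc /= expr0n addr0.
rewrite Re_sum => /le_trans; apply; rewrite lerD2l /T.
apply: ler_sum => k _; rewrite Re_sum; apply: ler_sum => l _.
by rewrite conjcK big_enum.
Qed.

(** This is ln x <= x - 1 at x = q / lam. The summands lam and q stay on opposite sides, which keeps
    the terms nonnegative when lam <= 1. *)
Lemma gibbs_pointwise {R : realType} (lam q : R) : 0 <= lam -> 0 < q ->
  - (lam * ln lam) + lam <= q + lam * (- ln q).
Proof.
rewrite le_eqVlt => /predU1P[<-|lam0] q0.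
  by rewrite !mul0r oppr0 !addr0 ltW.
have : ln (1 + (q / lam - 1)) <= q / lam - 1.
  by apply: le_ln1Dx; rewrite ltrBDr addNr divr_gt0.
rewrite addrC subrK ln_div ?posrE// => lnle.
have : lam * (ln q - ln lam) <= lam * (q / lam - 1) by rewrite ler_pM2l.
have -> : lam * (q / lam - 1) = q - lam by field; rewrite gt_eqF.
rewrite mulrBr mulrN; lra.
Qed.

Lemma geometric_weight_sum {R : realType} (r : R) : 0 < r < 1 ->
  (\sum_(j <oo) ((1 - r) * r ^+ j)%:E = 1)%E.
Proof.
move=> /andP[r0 r1].
have r1' : `|r| < 1 by rewrite gtr0_norm.
have := @cvg_geometric_series R (1 - r) r r1'.
rewrite divff ?subr_eq0 ?gt_eqF// => c1; apply/cvg_lim => //.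
apply/fine_cvgP; split.
  by apply: nearW => M; rewrite sumEFin.
apply: cvg_trans c1; apply: near_eq_cvg; apply: nearW => M.
by rewrite /= sumEFin.
Qed.

(* Gibbs' inequality against the thermal state with eigenvalues (1 - r) r ^ j
   in the Fock basis: the numbers |e_k(j)|^2 form a matrix whose rows sum to 1
   and whose columns sum to at most 1. *)
Lemma spectral_entropy_le {R : realType} (A : operator R nat) (lam : nat -> R)
    (e : nat -> nat -> R[i]) (r N : R) :
  spectral_decomposition A lam e -> 0 < r < 1 ->
  (\sum_(j <oo) (complex.Re (A j j))%:E = 1)%E ->
  (\sum_(j <oo) (j%:R * complex.Re (A j j))%:E <= N%:E)%E ->
  (\esum_(k in [set: nat]) (- (lam k * ln (lam k)))%:E <=
     (- ln (1 - r) - N * ln r)%:E)%E.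
Proof.
move=> [lam0 lam_fin e_fin eO AE] r01 A1 AN.
have /andP[r0 r1] := r01.
pose W k j := sqnormc (e k j).
have W0 k j : 0 <= W k j by exact: sqnormc_ge0.
have W0e k j : (0 <= (W k j)%:E)%E by rewrite lee_fin.
have lW0 k j : 0 <= lam k * W k j by rewrite mulr_ge0.
have lW0e k j : (0 <= (lam k * W k j)%:E)%E by rewrite lee_fin.
have W_row k : (\sum_(j <oo) (W k j)%:E = 1)%E.
  rewrite nneseries_esumT// -[LHS]fineK ?ge0_fin_numE ?esum_ge0 ?e_fin//.
  rewrite -ge0_rsum//; congr EFin.
  have /(congr1 (@complex.Re R)) /= := eO k k; rewrite eqxx /= => <-.
  by congr (rsum _ _); apply/funext => i; rewrite sqnormcE.
have W_col j : (\sum_(k <oo) (W k j)%:E <= 1)%E.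
  apply: lime_le; first exact: is_cvg_nneseries.
  apply: nearW => K; rewrite sumEFin lee_fin big_mkord.
  exact: bessel_basis_vector.
have W1 k j : W k j <= 1.
  have := bessel_basis_vector j k.+1 e_fin eO.
  rewrite big_ord_recr /=; apply: le_trans; rewrite lerDr.
  by apply: sumr_ge0 => i _; exact: W0.
have aE j : (complex.Re (A j j))%:E = (\sum_(k <oo) (lam k * W k j)%:E)%E.
  rewrite AE /csum /=.
  have -> : (fun k => complex.Re ((lam k)%:C * e k j * (e k j)^*%C)) =
      (fun k => lam k * W k j).
    by apply/funext => k; rewrite -mulrA [e k j * _]mulrC sqnormcE Re_mul /=
      mul0r subr0.
  rewrite ge0_rsum// fineK ?nneseries_esumT// ge0_fin_numE ?esum_ge0//.
  apply: le_lt_trans lam_fin; apply: le_esum => k _.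
  by rewrite lee_fin ler_piMr.
have a0 j : (0 <= (complex.Re (A j j))%:E)%E by rewrite aE nneseries_ge0.
(* Interchanging the two sums turns the trace of A into the sum of the eigenvalues, because the rows
   of [W] sum to 1. *)
have lam1 : (\sum_(k <oo) (lam k)%:E = 1)%E.
  rewrite -A1; under [RHS]eq_eseriesr do rewrite aE.
  rewrite nneseries_interchange//; apply: eq_eseriesr => k _.
  under [RHS]eq_eseriesr do rewrite EFinM.
  by rewrite nneseriesZl// W_row mule1.
have lam_le1 k : lam k <= 1.
  rewrite -lee_fin -lam1.
  apply: le_trans (nneseries_lim_ge k.+1 _); last by move=> *; rewrite lee_fin.
  rewrite big_nat_recr//= leeDr// sume_ge0// => i _.
  by rewrite lee_fin.
pose eta k := - (lam k * ln (lam k)).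
have eta0 k : 0 <= eta k by rewrite oppr_ge0 mulr_ge0_le0// ln_le0.
pose q j := (1 - r) * r ^+ j.
have q0 j : 0 < q j by rewrite mulr_gt0 ?subr_gt0// exprn_gt0.
pose c j := - ln (q j).
(* Minus the logarithm of a geometric weight is affine in j: only the trace and the mean number of A
   enter the final bound. *)
have cE j : c j = - ln (1 - r) + (- ln r) * j%:R.
  by rewrite /c lnM ?posrE ?subr_gt0 ?exprn_gt0// lnXn// -mulr_natr; ring.
have lnr0 : 0 <= - ln r by rewrite oppr_ge0 ln_le0// ltW.
have ln1r0 : 0 <= - ln (1 - r) by rewrite oppr_ge0 ln_le0// gerBl ltW.
have c0 j : 0 <= c j by rewrite cE addr_ge0// mulr_ge0.
rewrite -nneseries_esumT => [|k]; last by rewrite lee_fin; exact: eta0.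
(* The added 1 is the sum of the [lam k] on the left and of the [q j] on the right. All the series
   then have nonnegative terms and can be interchanged freely. *)
rewrite -(@leeD2rE _ 1%E)//.
have -> : (\sum_(k <oo) (- (lam k * ln (lam k)))%:E + 1 =
    \sum_(k <oo) \sum_(j <oo) ((eta k + lam k) * W k j)%:E)%E.
  rewrite -[X in (_ + X)%E]lam1 -nneseriesD; last 2 first.
  - by move=> k _ _; rewrite lee_fin; exact: eta0.
  - by move=> k _ _; rewrite lee_fin.
  apply: eq_eseriesr => k _.
  under [RHS]eq_eseriesr do rewrite EFinM.
  by rewrite nneseriesZl// W_row mule1.
apply: (@le_trans _ _
    (\sum_(k <oo) \sum_(j <oo) (q j * W k j + c j * (lam k * W k j))%:E)%E).
  apply: lee_nneseries => [k _ _|k _].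
    by apply: nneseries_ge0 => j _ _; rewrite lee_fin mulr_ge0// addr_ge0.
  apply: lee_nneseries => [j _ _|j _]; rewrite lee_fin.
    by rewrite mulr_ge0// addr_ge0.
  have -> : q j * W k j + c j * (lam k * W k j) =
    (q j + lam k * c j) * W k j by ring.
  by rewrite ler_wpM2r// gibbs_pointwise.
rewrite nneseries_interchange => [|k j]; last first.
  by rewrite lee_fin addr_ge0// mulr_ge0// ltW.
apply: (@le_trans _ _
    (\sum_(j <oo) ((q j)%:E + (c j)%:E * (complex.Re (A j j))%:E))%E).
  apply: lee_nneseries => [j _ _|j _].
    by apply: nneseries_ge0 => k _ _; rewrite lee_fin addr_ge0// mulr_ge0// ltW.
  under eq_eseriesr do rewrite EFinD (EFinM (q j)) (EFinM (c j)).
  rewrite nneseriesD; last 2 first.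
  - by move=> k _ _; rewrite -EFinM lee_fin mulr_ge0// ltW.
  - by move=> k _ _; rewrite -!EFinM lee_fin mulr_ge0.
  rewrite nneseriesZl// nneseriesZl => [|k _]; last exact: lW0e.
  rewrite aE leeD2r//; apply: le_trans (lee_wpmul2l _ (W_col j)) _.
    by rewrite lee_fin ltW.
  by rewrite mule1.
rewrite nneseriesD; last 2 first.
- by move=> j _ _; rewrite lee_fin ltW.
- by move=> j _ _; rewrite mule_ge0// lee_fin.
rewrite geometric_weight_sum// addeC leeD2r//.
have -> : (\sum_(j <oo) (c j)%:E * (complex.Re (A j j))%:E =
    \sum_(j <oo) ((- ln (1 - r))%:E * (complex.Re (A j j))%:E +
      (- ln r)%:E * (j%:R * complex.Re (A j j))%:E))%E.
  by apply: eq_eseriesr => j _; rewrite -!EFinM -EFinD cE; congr EFin; ring.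
rewrite nneseriesD; last 2 first.
- by move=> j _ _; rewrite mule_ge0// lee_fin.
- by move=> j _ _; rewrite mule_ge0 ?lee_fin ?mulr_ge0// -lee_fin.
rewrite nneseriesZl// A1 mule1 nneseriesZl => [|j _]; last first.
  by rewrite lee_fin mulr_ge0// -lee_fin.
have -> : - ln (1 - r) - N * ln r = - ln (1 - r) + (- ln r) * N by ring.
by rewrite EFinD leeD2l// EFinM lee_wpmul2l// lee_fin.
Qed.

Lemma eq_rsum {R : realType} (I : choiceType) (D : set I) (F G : I -> R) :
  (forall i, D i -> F i = G i) -> rsum D F = rsum D G.
Proof.
move=> FG; rewrite /rsum.
rewrite (@eq_esum _ _ _ _ (fun i => (Num.max (G i) 0)%:E)) => [|i /FG -> //].
by rewrite (@eq_esum _ _ _ (fun i => (Num.max (- F i) 0)%:E)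
  (fun i => (Num.max (- G i) 0)%:E)) => [|i /FG -> //].
Qed.

Lemma le_esumZl {R : realType} (I : choiceType) (D : set I) (a : I -> \bar R)
    (x : R) : 0 <= x -> (forall i, 0 <= a i)%E ->
  (x%:E * (\esum_(i in D) a i) <= \esum_(i in D) (x%:E * a i))%E.
Proof.
rewrite le_eqVlt => /predU1P[<- a0|x0 a0].
  by rewrite mul0e esum_ge0// => i _; rewrite mul0e.
rewrite -lee_pdivlMl//; apply: ge_ereal_sup => _ [X [finX XD] <-].
rewrite lee_pdivlMl//; apply: esum_ge; exists X => //.
by rewrite ge0_mule_fsumr.
Qed.

Lemma Re_rho_of_diag {R : realType} (n : nat) (tau : probability (Cn R n) R)
    (i : fock n) :
  complex.Re (rho_of tau i i) = \int[tau]_z sqnormc (coherent z i).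
Proof.
by apply: eq_Rintegral => z _; rewrite /coherent_state mulrC sqnormcE.
Qed.

Lemma fock_set_id (n : nat) (i : fock n) (k : 'I_n) : fock_set i k (i k) = i.
Proof. by apply/ffunP => l; rewrite ffunE; case: eqP => [->|]. Qed.

(** A finite partial sum commutes with the integral, and its integrand is bounded pointwise by
    [coherent_energy_le]. *)
Lemma energy_esum_le {R : realType} (n : nat) (tau : probability (Cn R n) R)
    (k : 'I_n) :
  (\esum_(i in [set: fock n]) ((i k)%:R * complex.Re (rho_of tau i i))%:E <=
   \int[tau]_z (sqmod (tnth z k))%:E)%E.
Proof.
have bc (i : fock n) : bounded_meas (fun z : Cn R n => (i k)%:R * sqnormc (coherent z i)).
  exact/bounded_measZ/cbounded_meas_sqnormc/cbounded_meas_coherent.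
apply: ge_ereal_sup => _ [X [finX _] <-].
rewrite fsbig_finite//= sumEFin.
have := finmap.fset_uniq (fset_set X).
move: (finmap.enum_fset (fset_set X)) => s us.
have -> : \sum_(i <- s) (i k)%:R * complex.Re (rho_of tau i i) =
    \int[tau]_z \sum_(i <- s) (i k)%:R * sqnormc (coherent z i).
  rewrite Rintegral_sum//; apply: eq_bigr => i _.
  rewrite Re_rho_of_diag -RintegralZl//; apply: bounded_meas_integrable.
  exact/cbounded_meas_sqnormc/cbounded_meas_coherent.
have bs := bounded_meas_sum s bc.
rewrite /Rintegral fineK; last first.
  exact/integrable_fin_num/bounded_meas_integrable.
apply: ge0_le_integral => //.
- move=> z _; rewrite lee_fin; apply: sumr_ge0 => i _.
  by rewrite mulr_ge0// sqnormc_ge0.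
- by apply/measurable_EFinP; case: bs.
- apply/measurable_EFinP; apply: (measurableT_comp measurable_sqmod).
  exact: measurable_tnth.
- by move=> z _; rewrite lee_fin coherent_energy_le.
Qed.

Lemma integral_marginal_sqmod {R : realType} (n : nat)
    (tau : probability (Cn R n) R) (k : 'I_n) :
  (\int[marginal tau k]_z (sqmod z)%:E =
   \int[tau]_z (sqmod (tnth z k))%:E)%E.
Proof.
have mf : measurable_fun [set: Cplx R] (fun z : Cplx R => (sqmod z)%:E).
  by apply/measurable_EFinP; exact: measurable_sqmod.
have mt : measurable_fun setT (fun z : Cn R n => tnth z k).
  exact: measurable_tnth.
have f0 : {in [set: Cplx R], forall z : Cplx R, (0 <= (sqmod z)%:E)%E}.
  by move=> z _; rewrite lee_fin sqmod_ge0.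
rewrite /marginal (ge0_integral_pushforward mt tau measurableT mf f0).
by rewrite preimage_setT; apply: eq_integral.
Qed.

(* Only this upper bound is needed, so that no spectral decomposition has to be
   constructed. *)
Lemma entropy_reduced_le {R : realType} (n : nat) (tau : probability (Cn R n) R)
    (k : 'I_n) (r N : R) : state (rho_of tau) -> 0 < r < 1 ->
  (\int[tau]_z (sqmod (tnth z k))%:E <= N%:E)%E ->
  (entropy (reduced k (rho_of tau)) <= (- ln (1 - r) - N * ln r)%:E)%E.
Proof.
move=> [_ tr1] r01 EN.
pose D i := complex.Re (rho_of tau i i).
have D0 i : 0 <= D i.
  by rewrite /D Re_rho_of_diag; apply: Rintegral_ge0 => z _; exact: sqnormc_ge0.
pose J j := [set i : fock n | i k = j].
have trivJ : trivIset [set: nat] J by move=> j l _ _ [i [<- <-]].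
have bigJ : \bigcup_(j in [set: nat]) J j = [set: fock n].
  by apply/seteqP; split=> i // _; exists (i k).
(* The diagonal of the partial trace sums the diagonal of the state over the fibres of i -> i_k, so
   both the trace and the mean number regroup over the partition [J]. *)
have aE j : (complex.Re (reduced k (rho_of tau) j j))%:E =
    (\esum_(i in J j) (D i)%:E)%E.
  rewrite /reduced /csum /=.
  have -> : rsum (J j) (fun i => complex.Re (rho_of tau i (fock_set i k j))) =
      rsum (J j) D.
    by apply: eq_rsum => i <-; rewrite fock_set_id.
  rewrite ge0_rsum// fineK// ge0_fin_numE ?esum_ge0// => [|i _]; last first.
    by rewrite lee_fin.
  apply: (@le_lt_trans _ _ 1%E); last exact: ltry.
  rewrite -tr1; apply: ge_ereal_sup => _ [X [finX XJ] <-]; apply: esum_ge.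
  by exists X.
apply: ge_ereal_sup => _ [lam [e [AE ->]]].
apply: spectral_entropy_le AE r01 _ _.
  rewrite nneseries_esumT => [|j]; last by rewrite aE esum_ge0// => *; rewrite lee_fin.
  under eq_esum do rewrite aE.
  by rewrite -esum_bigcupT ?bigJ// => i; rewrite lee_fin.
have a0 j : (0 <= (complex.Re (reduced k (rho_of tau) j j))%:E)%E.
  by rewrite aE esum_ge0// => *; rewrite lee_fin.
rewrite nneseries_esumT => [|j]; last by rewrite EFinM mule_ge0.
apply: (@le_trans _ _ (\esum_(i in [set: fock n]) ((i k)%:R * D i)%:E)%E).
  rewrite -bigJ esum_bigcupT => [|//|i]; last by rewrite lee_fin mulr_ge0.
  apply: le_esum => j _; rewrite EFinM aE.
  have De i : (0 <= (D i)%:E)%E by rewrite lee_fin.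
  apply: le_trans (@le_esumZl R _ (J j) (fun i => (D i)%:E) j%:R _ De) _ => //.
  by apply: le_esum => i <-; rewrite EFinM.
exact: le_trans (energy_esum_le tau k) EN.
Qed.

(** * Common part of two probability measures *)

(** An alias that carries the proof of finiteness, so that a finite-measure structure can be
    attached to a measure shown finite inside a proof. *)
Definition finite_copy d (T : measurableType d) (R : realType)
    (mu : {measure set T -> \bar R}) (fin : fin_num_fun mu) : set T -> \bar R :=
  mu.

HB.instance Definition _ d (T : measurableType d) (R : realType)
    (mu : {measure set T -> \bar R}) (fin : fin_num_fun mu) :=
  Measure.copy (finite_copy fin) mu.

HB.instance Definition _ d (T : measurableType d) (R : realType)
    (mu : {measure set T -> \bar R}) (fin : fin_num_fun mu) :=
  Measure_isFinite.Build _ _ _ (finite_copy fin) fin.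

(** Let P and N be a Hahn decomposition for mu - nu. The common part is the minimum of the two
    measures, nu on P and mu on N. The Jordan parts have the same mass t because both measures have
    mass 1; the first alternative is t = 0, where they cannot be normalized. *)
Lemma probability_common_part {d} {T : measurableType d} {R : realType}
    (mu nu : probability T R) :
  (forall A, measurable A -> mu A = nu A) \/
  exists (t : R) (kap : {finite_measure set T -> \bar R})
    (tp tm : probability T R) (P : set T),
    [/\ 0 < t, measure_split mu kap tp t, measure_split nu kap tm t,
        measurable P & t%:E = (mu P - nu P)%E].
Proof.
pose del : {charge set T -> \bar R} :=
  cadd (charge_of_finite_measure mu) (copp (charge_of_finite_measure nu)).
have delE A : del A = (mu A - nu A)%E by [].
have [P [N PN]] := Hahn_decomposition del.
have [[mP posP] [mN negN] PUN PIN] := PN.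
pose dp := jordan_pos PN; pose dm := jordan_neg PN.
have dpE A : measurable A -> dp A = (mu (A `&` P) - nu (A `&` P))%E.
  by move=> mA; rewrite /dp jordan_posE cjordan_posE /crestr0 mem_set.
have dmE A : measurable A -> dm A = (nu (A `&` N) - mu (A `&` N))%E.
  move=> mA; rewrite /dm jordan_negE cjordan_negE /crestr0 mem_set//.
  rewrite /crestr delE fin_num_oppeB ?fin_num_measure//; last exact: measurableI.
  by rewrite addeC.
have split_PN (m : probability T R) A : measurable A ->
    m A = (m (A `&` P) + m (A `&` N))%E.
  move=> mA; rewrite -measureU//; try exact: measurableI.
    by rewrite -setIUr PUN setIT.
  by rewrite setIACA PIN setI0.
have finI (m : probability T R) A B : measurable A -> measurable B ->
    m (A `&` B) \is a fin_num.
  by move=> mA mB; rewrite fin_num_measure//; exact: measurableI.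
have fin : fin_num_fun (measure_add (mrestr mu mN) (mrestr nu mP)).
  by move=> A mA; rewrite measure_addE fin_numD !finI.
pose kap : {finite_measure set T -> \bar R} := finite_copy fin.
have kapE' A : kap A = (mu (A `&` N) + nu (A `&` P))%E.
  exact: measure_addE.
have mu_split A : measurable A -> mu A = (kap A + dp A)%E.
  move=> mA; rewrite kapE' dpE// split_PN//.
  have := finI nu A P mA mP; have := finI mu A P mA mP.
  have := finI mu A N mA mN.
  move=> /fineK <- /fineK <- /fineK <-; rewrite -!EFinD; congr EFin; ring.
have nu_split A : measurable A -> nu A = (kap A + dm A)%E.
  move=> mA; rewrite kapE' dmE// split_PN//.
  have := finI nu A P mA mP; have := finI nu A N mA mN.
  have := finI mu A N mA mN.
  move=> /fineK <- /fineK <- /fineK <-; rewrite -!EFinD; congr EFin; ring.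
have dpT : dp setT = (mu P - nu P)%E by rewrite dpE// setTI.
have dmT : dm setT = dp setT.
  have : (kap setT + dp setT = kap setT + dm setT)%E.
    rewrite -mu_split// -nu_split//.
    by rewrite (probability_setT mu) (probability_setT nu).
  have : kap setT \is a fin_num by exact: fin_num_measure.
  have : dp setT \is a fin_num by exact: fin_num_measure.
  have : dm setT \is a fin_num by exact: fin_num_measure.
  move=> /fineK <- /fineK <- /fineK <-; rewrite -!EFinD => -[] /addrI ->.
  by [].
pose t := fine (dp setT).
have tE : dp setT = t%:E by rewrite fineK// fin_num_measure.
have t0 : 0 <= t by rewrite fine_ge0.
move: t0; rewrite le_eqVlt => /predU1P[t0|t0].
  left=> A mA.
  have null (m : {measure set T -> \bar R}) : m setT = 0%E -> m A = 0%E.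
    move=> m0; apply/eqP; rewrite eq_le measure_ge0 andbT -m0.
    by apply: le_measure; rewrite ?inE.
  have dp0 : dp A = 0%E by apply: null; exact: etrans tE (congr1 EFin (esym t0)).
  have dm0 : dm A = 0%E.
    by apply: null; exact: etrans dmT (etrans tE (congr1 EFin (esym t0))).
  by rewrite mu_split// nu_split// dp0 dm0.
right.
(* The second argument of [mnormalize] is a fallback for mass 0 or infinity, excluded by 0 < t. *)
have normE (m : {measure set T -> \bar R}) A : m setT = t%:E ->
    m A = (t%:E * mnormalize m mu A)%E.
  move=> mT; rewrite /mnormalize mT eqe gt_eqF//= muleCA -EFinM.
  by rewrite divff ?gt_eqF// mule1.
exists t, kap, (mnormalize dp mu), (mnormalize dm mu), P; split => //.
- by move=> A mA; rewrite mu_split//; congr (_ + _)%E; exact: normE.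
- move=> A mA; rewrite nu_split//; congr (_ + _)%E; apply: normE.
  exact: etrans dmT tE.
- by rewrite -tE.
Qed.

(** * Comparison of mixtures *)

Lemma rho_of_split {R : realType} (n : nat) (mu tau : probability (Cn R n) R)
    (kap : {finite_measure set (Cn R n) -> \bar R}) (t : R) (i j : fock n) :
  0 <= t -> measure_split mu kap tau t ->
  rho_of mu i j = cint kap (fun z => coherent_state z i j) +
    t%:C * rho_of tau i j.
Proof.
move=> t0 mukt.
exact: (cint_split t0 mukt (cbounded_meas_coherent_state i j)).
Qed.

(** The quadratic form at x is the integral of |<x|z>|^2. For [kap] the common part, this operator
    is the difference between rho(mu) and t rho(tau). *)
Lemma positive_cint_coherent {R : realType} (n : nat)
    (kap : {finite_measure set (Cn R n) -> \bar R}) :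
  positive_op (fun i j => cint kap (fun z => coherent_state z i j)).
Proof.
move=> s x us.
have bx i j : cbounded_meas
    (fun z : Cn R n => (x i)^*%C * coherent_state z i j * x j).
  apply: cbounded_measM; last exact: cbounded_meas_cst.
  by apply: cbounded_measM;
    [exact: cbounded_meas_cst|exact: cbounded_meas_coherent_state].
pose y (z : Cn R n) := \sum_(i <- s) (x i)^*%C * coherent z i.
have -> : \sum_(i <- s) \sum_(j <- s)
    (x i)^*%C * cint kap (fun z => coherent_state z i j) * x j =
    cint kap (fun z => (sqnormc (y z))%:C).
  transitivity (cint kap (fun z => \sum_(i <- s) \sum_(j <- s)
      (x i)^*%C * coherent_state z i j * x j)).
    rewrite cint_sum => [|i]; last exact: cbounded_meas_sum.
    apply: eq_bigr => i _; rewrite cint_sum//; apply: eq_bigr => j _.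
    rewrite mulrAC -cintZ; last exact: cbounded_meas_coherent_state.
    by apply: eq_cint => z; rewrite mulrAC.
  apply: eq_cint => z; rewrite -sqnormcE mulrC {1}/y mulr_suml.
  apply: eq_bigr => i _; rewrite /y conjc_sum mulr_sumr; apply: eq_bigr => j _.
  by rewrite conjcM conjcK /coherent_state; ring.
rewrite lecE /cint /= Rintegral_cst// mul0r eqxx /=.
by apply: Rintegral_ge0 => z _; exact: sqnormc_ge0.
Qed.

(** * Energy and entropy of the components of a splitting *)

Lemma energyE {R : realType} (n m : nat) (tau : probability (Cn R n) R) :
  (energy m tau =
   \sum_(k < n | (k < m)%N) \int[tau]_z (sqmod (tnth z k))%:E)%E.
Proof. by apply: eq_bigr => k _; exact: integral_marginal_sqmod. Qed.

Lemma integral_sqmod_ge0 {R : realType} (n : nat)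
    (tau : {measure set (Cn R n) -> \bar R}) (k : 'I_n) :
  (0 <= \int[tau]_z (sqmod (tnth z k))%:E)%E.
Proof. by apply: integral_ge0 => z _; rewrite lee_fin sqmod_ge0. Qed.

Lemma energy_ge0 {R : realType} (n m : nat) (tau : probability (Cn R n) R) :
  (0 <= energy m tau)%E.
Proof. by rewrite energyE sume_ge0// => k _; exact: integral_sqmod_ge0. Qed.

Lemma energy_split_le {R : realType} (n m : nat)
    (mu tau : probability (Cn R n) R)
    (kap : {finite_measure set (Cn R n) -> \bar R}) (t : R) :
  0 <= t -> measure_split mu kap tau t ->
  (t%:E * energy m tau <= energy m mu)%E.
Proof.
move=> t0 mukt; rewrite !energyE ge0_sume_distrr => [|k _]; last first.
  exact: integral_sqmod_ge0.
apply: lee_sum => k _; rewrite (ge0_integral_split t0 mukt).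
- by rewrite leeDr// integral_sqmod_ge0.
- apply/measurable_EFinP; apply: (measurableT_comp measurable_sqmod).
  exact: measurable_tnth.
- by move=> z; rewrite lee_fin sqmod_ge0.
Qed.

(** For a fixed r the bounds of the single modes are affine in their energies with the same slope,
    so only the total energy enters. *)
Lemma entropies_le {R : realType} (n m : nat) (tau : probability (Cn R n) R)
    (r e : R) : (m <= n)%N -> state (rho_of tau) -> 0 < r < 1 ->
  (energy m tau <= e%:E)%E ->
  (entropies m (rho_of tau) <= (m%:R * - ln (1 - r) - e * ln r)%:E)%E.
Proof.
move=> mn st r01; rewrite energyE => Ee.
pose I k := (\int[tau]_z (sqmod (tnth z k))%:E)%E.
have I0 k : (0 <= I k)%E by exact: integral_sqmod_ge0.
have Ifin (k : 'I_n) : (k < m)%N -> I k \is a fin_num.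
  move=> km; rewrite ge0_fin_numE//; apply: (@le_lt_trans _ _ e%:E); last first.
    exact: ltry.
  apply: le_trans Ee; rewrite (bigD1 k)//= leeDl// sume_ge0// => l _.
  exact: I0.
pose N k := fine (I k).
apply: (@le_trans _ _ (\sum_(k < n | (k < m)%N)
    (- ln (1 - r) - N k * ln r)%:E)%E).
  apply: lee_sum => k km; apply: entropy_reduced_le => //.
  by rewrite fineK// Ifin.
have -> : (\sum_(k < n | (k < m)%N) (- ln (1 - r) - N k * ln r)%:E)%E =
    (m%:R * - ln (1 - r) - (\sum_(k < n | (k < m)%N) N k) * ln r)%:E.
  rewrite sumEFin big_split /=; congr (_ + _)%:E; last by rewrite sumrN mulr_suml.
  rewrite -(big_ord_widen n (fun=> - ln (1 - r)) mn).
  by rewrite sumr_const card_ord mulr_natl.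
rewrite lee_fin lerD2l lerN2.
have /andP[r0 r1] := r01.
rewrite ler_wnM2r ?ln_le0 ?(ltW r1)// -lee_fin -sumEFin.
apply: le_trans Ee; rewrite le_eqVlt; apply/orP; left; apply/eqP.
by apply: eq_bigr => k km; rewrite fineK// Ifin.
Qed.

(** For E > 0 the minimum over r is attained at r = E / (E + eps), with value m eps g(E / eps). For
    E = 0 it is only approached, as r tends to 0. *)
Lemma infimum_thermal_bound {R : realType} (m : nat) (E eps : R) (x : \bar R) :
  (0 < m)%N -> 0 <= E -> 0 < eps ->
  (forall r : R, 0 < r < 1 ->
    (x <= (m%:R * (eps * - ln (1 - r) - E * ln r))%:E)%E) ->
  (x <= (eps * m%:R * g (E / eps))%:E)%E.
Proof.
move=> m0; rewrite le_eqVlt => /predU1P[<-|E0] eps0 xr.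
  rewrite /g mul0r ltxx mulr0; apply/lee_addgt0Pr => del del0; rewrite add0e.
  have me0 : 0 < m%:R * eps by rewrite mulr_gt0// ltr0n.
  have d0 : - (del / (m%:R * eps)) < 0 by rewrite oppr_lt0 divr_gt0.
  (* This r makes the bound equal to [del]. *)
  have := xr (1 - expR (- (del / (m%:R * eps)))).
  rewrite subr_gt0 expR_lt1 d0 gtrBl expR_gt0 /= => /(_ isT) /le_trans; apply.
  rewrite lee_fin mul0r subr0 opprB addrC subrK expRK opprK.
  by rewrite le_eqVlt; apply/orP; left; apply/eqP; field; rewrite ?gt_eqF// ?ltr0n.
have Ee0 : 0 < E + eps by rewrite addr_gt0.
have := xr (E / (E + eps)).
rewrite divr_gt0//= ltr_pdivrMr// mul1r ltrDl eps0 => /(_ isT) /le_trans; apply.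
rewrite lee_fin /g divr_gt0//.
have -> : 1 - E / (E + eps) = eps / (E + eps) by field; rewrite gt_eqF.
have -> : E / eps + 1 = (E + eps) / eps by field; rewrite gt_eqF.
rewrite !ln_div ?posrE//.
by rewrite le_eqVlt; apply/orP; left; apply/eqP; field; rewrite gt_eqF.
Qed.

Lemma g_ge0 {R : realType} (x : R) : 0 <= g x.
Proof.
rewrite /g; case: ifPn => // x0.
have x1 : 0 < x + 1 by rewrite addr_gt0.
have l0 : 0 <= ln (x + 1) by rewrite ln_ge0// lerDr ltW.
have : x * ln x <= x * ln (x + 1) by rewrite ler_pM2l// ler_ln ?posrE// lerDl.
nra.
Qed.

(* (1 + t) h2 (1 / (1 + t)) = g t, and g is nondecreasing. *)
Lemma h2_le_g {R : realType} (t eps : R) : 0 < t -> t <= eps ->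
  (1 + t) * h2 (1 + t)^-1 <= g eps.
Proof.
move=> t0 te; have eps0 : 0 < eps by exact: lt_le_trans te.
have t1 : 0 < 1 + t by rewrite addr_gt0.
have e1 : 0 < eps + 1 by rewrite addr_gt0.
rewrite /g eps0 /h2; set p := (1 + t)^-1.
have p0 : 0 < p by rewrite invr_gt0.
have pE : 1 - p = t * p by rewrite /p; field; rewrite gt_eqF.
have tp : (1 + t) * p = 1 by rewrite divff// gt_eqF.
have p0' : 0 < 1 - p by rewrite pE mulr_gt0.
(* Gibbs' inequality for (p, 1 - p) against the value of this pair at t = eps. After multiplication
   by 1 + t the bound is affine and nondecreasing in t, and equals g(eps) at t = eps. *)
have H1 := @gibbs_pointwise _ p (eps + 1)^-1 (ltW p0).
rewrite invr_gt0 e1 lnV ?posrE// opprK in H1.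
have H2 := @gibbs_pointwise _ (1 - p) (eps / (eps + 1)) (ltW p0').
rewrite divr_gt0// ln_div ?posrE// opprB in H2.
have q1 : (eps + 1)^-1 + eps / (eps + 1) = 1 by field; rewrite gt_eqF.
have H : - (p * ln p) - (1 - p) * ln (1 - p) <=
    p * ln (eps + 1) + (1 - p) * (ln (eps + 1) - ln eps).
  by have := H1 isT; have := H2 isT; lra.
have : (1 + t) * (- (p * ln p) - (1 - p) * ln (1 - p)) <=
  (1 + t) * (p * ln (eps + 1) + (1 - p) * (ln (eps + 1) - ln eps)).
  by rewrite ler_pM2l.
move=> /le_trans; apply.
have -> : (1 + t) * (p * ln (eps + 1) + (1 - p) * (ln (eps + 1) - ln eps)) =
    ln (eps + 1) + t * (ln (eps + 1) - ln eps).
  rewrite pE; transitivity ((1 + t) * p *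
      (ln (eps + 1) + t * (ln (eps + 1) - ln eps))); first by ring.
  by rewrite tp mul1r.
have le : ln eps <= ln (eps + 1) by rewrite ler_ln ?posrE// lerDl.
have : t * (ln (eps + 1) - ln eps) <= eps * (ln (eps + 1) - ln eps).
  by rewrite ler_wpM2r// subr_ge0.
lra.
Qed.

(** The factor t cancels against the bound m E / t on the energy of tau. What remains, m (- t ln (1
    - r) - E ln r), is increasing in t, so t is replaced by eps before r is optimized. *)
Lemma scaled_entropies_le {R : realType} (n m : nat) (tau : probability (Cn R n) R)
    (t eps E : R) : (1 <= m <= n)%N -> state (rho_of tau) ->
  0 < t -> t <= eps -> (t%:E * energy m tau <= (m%:R * E)%:E)%E ->
  (t%:E * entropies m (rho_of tau) <= (eps * m%:R * g (E / eps))%:E)%E.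
Proof.
move=> /andP[m0 mn] st t0 te tE.
have mR0 : 0 < m%:R :> R by rewrite ltr0n.
have E0 : 0 <= E.
  rewrite -(pmulr_rge0 _ mR0) -lee_fin; apply: le_trans tE.
  by rewrite mule_ge0 ?energy_ge0// lee_fin ltW.
have eps0 : 0 < eps by exact: lt_le_trans te.
apply: infimum_thermal_bound => // r r01; have /andP[r0 r1] := r01.
have Ele : (energy m tau <= (t^-1 * (m%:R * E))%:E)%E.
  by rewrite EFinM lee_pdivlMl.
apply: (@le_trans _ _ (t%:E *
    (m%:R * - ln (1 - r) - t^-1 * (m%:R * E) * ln r)%:E)%E).
  by rewrite lee_wpmul2l ?lee_fin ?(ltW t0)// entropies_le.
rewrite -EFinM lee_fin.
have -> : t * (m%:R * - ln (1 - r) - t^-1 * (m%:R * E) * ln r) =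
    m%:R * (t * - ln (1 - r) - E * ln r) by field; rewrite gt_eqF.
rewrite ler_pM2l// lerD2r ler_wpM2r// oppr_ge0 ln_le0// gerBl; exact: ltW.
Qed.

(** * Continuity bound on the class L *)

(** Finite energy forces finite values, uniformly over the class, so that finiteness passes to
    infima and suprema. The entropy bound is the scaled one with t = eps = 1. *)
Lemma Lclass_bounds {R : realType} (n m : nat) (C D E : R)
    (S0 : set (operator R (fock n))) (f : operator R (fock n) -> \bar R)
    (tau : probability (Cn R n) R) : (1 <= m <= n)%N ->
  (forall rho, S0 rho -> state rho) -> Lclass m C D S0 f ->
  S0 (rho_of tau) -> (energy m tau <= (m%:R * E)%:E)%E ->
  (- (C * (m%:R * g E))%:E <= f (rho_of tau) <= (C * (m%:R * g E))%:E)%E.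
Proof.
move=> hmn S0st [fNy [cm [cp [dm [dp [[cm0 cp0 dm0 dp0] cC dD _ fS]]]]]] St EE.
have ent : (entropies m (rho_of tau) <= (m%:R * g E)%:E)%E.
  have := @scaled_entropies_le R n m tau 1 1 E hmn (S0st _ St) ltr01 (lexx 1).
  by rewrite !mul1e mul1r divr1; apply.
have mg0 : 0 <= m%:R * g E by rewrite mulr_ge0// g_ge0.
have [lo up] := fS _ St.
apply/andP; split.
  apply: le_trans lo; rewrite leeN2.
  apply: le_trans (lee_wpmul2l _ ent) _; first by rewrite lee_fin.
  by rewrite -EFinM lee_fin ler_wpM2r// -cC lerDl.
apply: le_trans up _; apply: le_trans (lee_wpmul2l _ ent) _.
  by rewrite lee_fin.
by rewrite -EFinM lee_fin ler_wpM2r// -cC lerDr.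
Qed.

(** The disjunction on nu covers both statements: it serves only to bound f(rho(tau^-)) from below,
    by energy in A and by nonnegativity in B. *)
Lemma Lclass_one_sided {R : realType} (n m : nat) (C D E eps : R)
    (S0 : set (operator R (fock n))) (f : operator R (fock n) -> \bar R)
    (mu nu : probability (Cn R n) R) : (1 <= m <= n)%N ->
  convex_set_of_states S0 -> classically_hereditary S0 -> 0 < eps ->
  Lclass m C D S0 f -> S0 (rho_of mu) -> S0 (rho_of nu) ->
  (energy m mu <= (m%:R * E)%:E)%E ->
  (energy m nu <= (m%:R * E)%:E)%E \/ (forall rho, S0 rho -> (0 <= f rho)%E) ->
  (forall A, measurable A -> (mu A - nu A <= eps%:E)%E) ->
  (f (rho_of mu) <= f (rho_of nu) +
     (C * eps * m%:R * g (E / eps) + D * g eps)%:E)%E.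
Proof.
move=> hmn [S0st S0mix] hered eps0 Lf Smu Snu Emu Enu TVle.
have mu_fin : f (rho_of mu) \is a fin_num.
  have /andP[lo up] := Lclass_bounds hmn S0st Lf Smu Emu.
  by rewrite fin_numElt (lt_le_trans (ltNyr _) lo) (le_lt_trans up (ltry _)).
have [fNy [cm [cp [dm [dp [[cm0 cp0 dm0 dp0] cC dD fmix fS]]]]]] := Lf.
have C0 : 0 <= C by rewrite -cC addr_ge0.
have D0 : 0 <= D by rewrite -dD addr_ge0.
have X0 : 0 <= eps * m%:R * g (E / eps).
  by rewrite mulr_ge0 ?g_ge0// mulr_ge0// ltW.
set X := eps * m%:R * g (E / eps) in X0.
have -> : C * eps * m%:R * g (E / eps) = C * X by rewrite /X; ring.
have [eqmn|[t [kap [tp [tm [P [t0 mu_split nu_split mP tP]]]]]]] :=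
  probability_common_part mu nu.
  have -> : rho_of mu = rho_of nu.
    apply/funext => i; apply/funext => j; rewrite /rho_of /Rintegral.
    by congr (fine _ +i* fine _); apply: eq_measure_integral => A mA _; exact: eqmn.
  by rewrite leeDl// lee_fin addr_ge0// mulr_ge0// g_ge0.
have te : t <= eps by rewrite -lee_fin tP TVle.
have t1 : 0 < 1 + t by rewrite addr_gt0.
have sub_state (m' tau : probability (Cn R n) R) :
    measure_split m' kap tau t -> S0 (rho_of m') -> S0 (rho_of tau).
  move=> sp Sm; apply: (hered _ Sm (classical_rho_of m')).
  split; first exact: classical_rho_of.
  exists t => //; have := positive_cint_coherent kap.
  congr positive_op; apply/funext => i; apply/funext => j.
  by rewrite (rho_of_split i j (ltW t0) sp) /op_scale addrK.
have Stp := sub_state _ _ mu_split Smu; have Stm := sub_state _ _ nu_split Snu.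
pose p := (1 + t)^-1.
have p0 : 0 < p by rewrite invr_gt0.
have pE : 1 - p = t * p by rewrite /p; field; rewrite gt_eqF.
have tp1 : (1 + t) * p = 1 by rewrite divff// gt_eqF.
have p01 : 0 <= p <= 1.
  by rewrite (ltW p0) -subr_ge0 pE mulr_ge0// ltW.
(* Both sides are p times the common part plus t rho(tau^+) + t rho(tau^-), because 1 - p = t p. *)
have mixE : op_mix p (rho_of mu) (rho_of tm) = op_mix p (rho_of nu) (rho_of tp).
  apply/funext => i; apply/funext => j; rewrite /op_mix pE rmorphM /=.
  rewrite (rho_of_split i j (ltW t0) mu_split).
  rewrite (rho_of_split i j (ltW t0) nu_split); ring.
have scaled_ent (m' tau : probability (Cn R n) R) :
    measure_split m' kap tau t -> S0 (rho_of tau) ->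
    (energy m m' <= (m%:R * E)%:E)%E ->
    (t%:E * entropies m (rho_of tau) <= X%:E)%E.
  move=> sp Stau Em'; apply: scaled_entropies_le => //; first exact: S0st.
  exact: le_trans (energy_split_le m (ltW t0) sp) Em'.
(* The lower inequality for the first mixture and the upper one for the second sandwich the common
   value of f. *)
have [low _] := fmix _ _ p Smu Stm p01.
have [_ up] := fmix _ _ p Snu Stp p01.
rewrite mixE in low; have lu := le_trans low up.
have tp_up : (t%:E * f (rho_of tp) <= (cp * X)%:E)%E.
  apply: (@le_trans _ _ (t%:E * (cp%:E * entropies m (rho_of tp)))%E).
    by rewrite lee_wpmul2l ?lee_fin ?(ltW t0)//; have [] := fS _ Stp.
  rewrite muleCA EFinM lee_wpmul2l ?lee_fin//.
  exact: scaled_ent mu_split Stp Emu.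
have tm_low : (- (cm * X)%:E <= t%:E * f (rho_of tm))%E.
  case: Enu => [Enu|f0]; last first.
    apply: (@le_trans _ _ 0%E); first by rewrite leeNl oppe0 lee_fin mulr_ge0.
    by rewrite mule_ge0 ?lee_fin ?(ltW t0)// f0.
  apply: (@le_trans _ _ (t%:E * - (cm%:E * entropies m (rho_of tm)))%E).
    rewrite muleN leeN2 muleCA EFinM lee_wpmul2l ?lee_fin//.
    exact: scaled_ent nu_split Stm Enu.
  by rewrite lee_wpmul2l ?lee_fin ?(ltW t0)//; have [] := fS _ Stm.
have G := h2_le_g t0 te.
(* Infinite values: at rho(nu) the claim is trivial, at rho(tau^+) the entropy bound excludes them,
   and at rho(tau^-) they would make the left side of [lu] infinite but not the right one. *)
move: (fNy _ Snu) (fNy _ Stp) (fNy _ Stm) lu tp_up tm_low.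
move: mu_fin; case: (f (rho_of mu)) => [a| |] // _.
case: (f (rho_of nu)) => [c| |] // _; last by move=> *; rewrite addye// leey.
case: (f (rho_of tp)) => [d| |] // _; last first.
  by move=> _ _; rewrite gt0_muley ?lte_fin.
case: (f (rho_of tm)) => [b| |] // _; last first.
  by rewrite gt0_muley ?lte_fin// pE mulr_gt0.
rewrite -!EFinM -!EFinD -!EFinN !lee_fin => lu tp_up tm_low.
have : (1 + t) * (p * a + (1 - p) * b - dm * h2 p) <=
    (1 + t) * (p * c + (1 - p) * d + dp * h2 p) by rewrite ler_pM2l.
rewrite pE.
have -> : (1 + t) * (p * a + t * p * b - dm * h2 p) =
    (1 + t) * p * (a + t * b) - dm * ((1 + t) * h2 p) by ring.
have -> : (1 + t) * (p * c + t * p * d + dp * h2 p) =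
    (1 + t) * p * (c + t * d) + dp * ((1 + t) * h2 p) by ring.
rewrite tp1 !mul1r -/p in G *.
have : D * ((1 + t) * h2 p) <= D * g eps by rewrite ler_wpM2l.
rewrite -dD -cC; move: (g eps) ((1 + t) * h2 p) => x y; nra.
Qed.

(** * Passage to infima and suprema *)

Lemma abs_sub_le_ereal {R : realType} (x y : \bar R) (K : R) :
  x \is a fin_num -> y \is a fin_num ->
  (x <= y + K%:E)%E -> (y <= x + K%:E)%E -> (`|x - y| <= K%:E)%E.
Proof.
move=> /fineK <- /fineK <-; rewrite -!EFinD !lee_fin => xy yx.
by rewrite ler_norml; apply/andP; split; lra.
Qed.

(** A one-sided comparison with a constant uniform over K survives both operations; the two-sided
    bound of A is obtained by exchanging x and y. *)
Lemma inf_sup_extension_ind {R : realType} (T : Type) (S0 : set T)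
    (K : set (T -> \bar R)) (f : T -> \bar R) (x y : T) (B : \bar R) :
  S0 x -> S0 y -> (B \is a fin_num) ->
  (forall h, K h -> (h x <= h y + B)%E) ->
  inf_sup_extension S0 K f -> (f x <= f y + B)%E.
Proof.
move=> Sx Sy Bfin KB [/KB //|[F [[h0 Fh0] FK [fE|fE]]]]; rewrite !fE//.
  rewrite -leeBlDr//; apply: le_ereal_inf_tmp => _ [h Fh <-].
  rewrite leeBlDr//; apply: le_trans (KB _ (FK _ Fh)).
  by apply: ereal_inf_lbound; exists h.
apply: ge_ereal_sup => _ [h Fh <-]; apply: le_trans (KB _ (FK _ Fh)) _.
by rewrite leeD2r//; apply: ereal_sup_ubound; exists h.
Qed.

(** The member [h0] of the nonempty family bounds an infimum from above and a supremum from
    below. *)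
Lemma inf_sup_extension_bounds {R : realType} (T : Type) (S0 : set T)
    (K : set (T -> \bar R)) (f : T -> \bar R) (x : T) (a b : \bar R) :
  S0 x -> (forall h, K h -> (a <= h x <= b)%E) ->
  inf_sup_extension S0 K f -> (a <= f x <= b)%E.
Proof.
move=> Sx Kab [/Kab //|[F [[h0 Fh0] FK [fE|fE]]]]; rewrite !fE//;
  have /andP[a0 b0] := Kab _ (FK _ Fh0); apply/andP; split.
- by apply: le_ereal_inf_tmp => _ [h Fh <-]; have /andP[] := Kab _ (FK _ Fh).
- by apply: le_trans b0; apply: ereal_inf_lbound; exists h0.
- by apply: le_trans a0 _; apply: ereal_sup_ubound; exists h0.
- by apply: ge_ereal_sup => _ [h Fh <-]; have /andP[] := Kab _ (FK _ Fh).
Qed.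

Lemma fin_num_between {R : realType} (x : \bar R) (a b : R) :
  (a%:E <= x <= b%:E)%E -> x \is a fin_num.
Proof.
move=> /andP[ax xb].
by rewrite fin_numElt (lt_le_trans (ltNyr _) ax) (le_lt_trans xb (ltry _)).
Qed.

Unset Implicit Arguments.

Theorem proposition7 (R : realType) (n m : nat) (hmn : (1 <= m <= n)%N)
    (S0 : set (operator R (fock n)))
    (hS0 : convex_set_of_states S0) (hcl : classically_hereditary S0)
    (C D E eps : R) (heps : 0 < eps) :
  (forall f, Lhat m C D S0 f ->
    forall mu nu : probability (Cn R n) R,
      S0 (rho_of mu) -> S0 (rho_of nu) ->
      (energy m mu <= (m%:R * E)%:E)%E -> (energy m nu <= (m%:R * E)%:E)%E ->
      (TV mu nu <= eps%:E)%E ->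
      (`|f (rho_of mu) - f (rho_of nu)|
         <= (C * eps * m%:R * g (E / eps) + D * g eps)%:E)%E) /\
  (forall f, Lhat_ge0 m C D S0 f ->
    forall mu : probability (Cn R n) R,
      S0 (rho_of mu) -> (energy m mu <= (m%:R * E)%:E)%E ->
      forall nu : probability (Cn R n) R,
      S0 (rho_of nu) -> (TV mu nu <= eps%:E)%E ->
      (f (rho_of mu) - f (rho_of nu)
         <= (C * eps * m%:R * g (E / eps) + D * g eps)%:E)%E).
Proof.
have S0st := hS0.1.
have TVle (mu nu : probability (Cn R n) R) A : measurable A ->
    (TV mu nu <= eps%:E)%E -> (`|mu A - nu A| <= eps%:E)%E.
  by move=> mA; apply: le_trans; apply: ereal_sup_ubound; exists A.
have TVl (mu nu : probability (Cn R n) R) A : (TV mu nu <= eps%:E)%E ->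
    measurable A -> (mu A - nu A <= eps%:E)%E.
  by move=> tv mA; apply: le_trans (lee_abs _) (TVle _ _ _ mA tv).
have TVr (mu nu : probability (Cn R n) R) A : (TV mu nu <= eps%:E)%E ->
    measurable A -> (nu A - mu A <= eps%:E)%E.
  move=> tv mA; apply: le_trans (TVle _ _ _ mA tv).
  by rewrite -abseN fin_num_oppeB ?fin_num_measure// addeC lee_abs.
split=> [f Lf mu nu Smu Snu Emu Enu tv|f Lf mu Smu Emu nu Snu tv].
  apply: abs_sub_le_ereal.
  - apply: fin_num_between; apply: (inf_sup_extension_bounds Smu _ Lf) => h Lh.
    exact: Lclass_bounds hmn S0st Lh Smu Emu.
  - apply: fin_num_between; apply: (inf_sup_extension_bounds Snu _ Lf) => h Lh.
    exact: Lclass_bounds hmn S0st Lh Snu Enu.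
  - apply: (inf_sup_extension_ind Smu Snu _ _ Lf) => // h Lh.
    apply: (Lclass_one_sided hmn hS0 hcl heps Lh Smu Snu Emu).
      by left.
    by move=> A; exact: TVl.
  - apply: (inf_sup_extension_ind Snu Smu _ _ Lf) => // h Lh.
    apply: (Lclass_one_sided hmn hS0 hcl heps Lh Snu Smu Enu).
      by left.
    by move=> A; exact: TVr tv.
have mufin : f (rho_of mu) \is a fin_num.
  apply: fin_num_between; apply: (inf_sup_extension_bounds Smu _ Lf) => h [Lh _].
  exact: Lclass_bounds hmn S0st Lh Smu Emu.
have : (f (rho_of mu) <= f (rho_of nu) +
    (C * eps * m%:R * g (E / eps) + D * g eps)%:E)%E.
  apply: (inf_sup_extension_ind Smu Snu _ _ Lf) => // h [Lh h0].
  apply: (Lclass_one_sided hmn hS0 hcl heps Lh Smu Snu Emu).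
    by right.
  by move=> A; exact: TVl.
(* As f(rho(mu)) is finite, the value +oo at rho(nu) makes the difference -oo, and the value -oo
   would contradict the one-sided bound. *)
move: mufin; case: (f (rho_of mu)) => [a| |] // _.
case: (f (rho_of nu)) => [c| |] //; last by rewrite addeNy// leNye.
by rewrite -EFinB -EFinD !lee_fin lerBlDl.
Qed.
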